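(* Let $\Omega$ be a domain in $\mathbb{C}$. (1) If $\partial\Omega$ satisfies condition $(U)_{1,\alpha}$ for some $\alpha\in(1,2)$, then there exists $\alpha'>1$ such that $\Omega$ satisfies $(\Delta)_{1,\alpha'}$. Conversely, if $\Omega$ satisfies $(\Delta)_{1,\alpha'}$ for some $\alpha'>1$, then there exists $\alpha>1$ such that $\partial\Omega$ satisfies $(U)_{1,\alpha}$. (2) $\partial\Omega$ satisfies $(U)_{2,\beta}$ for some $\beta>0$ if and only if $\Omega$ satisfies $(\Delta)_{2,\beta'}$ for some $\beta'>0$.
   Context: For an increasing function $h$ on $[0,r_0)$ with $h(r)\le r$, a closed set $K\subset\mathbb{C}$ is $h$-uniformly perfect if $\{z\in\mathbb{C}: h(r)\le|z-a|\le r\}\cap K\neq\emptyset$ for every $a\in K$ and every $r\in(0,r_0)$. Let $h_{1,\alpha}(r)=r^\alpha$ ($\alpha>1$) and $h_{2,\beta}(r)=r(\log\frac1r)^{-\beta}$ ($\beta>0$). A closed set satisfies condition $(U)_{1,\alpha}$ (resp. $(U)_{2,\beta}$) if there exist constants $C>0$ and $r_0>0$ such that it is $Ch_{1,\alpha}$-uniformly perfect (resp. $Ch_{2,\beta}$-uniformly perfect) with that $r_0$. For $a\in\partial\Omega$ and $r>0$, $w_{a,r}$ denotes the harmonic measure of $\Omega\cap\partial D(a,r)$ relative to the open set $\Omega\cap D(a,r)$. For an increasing function $h$, $\Omega$ satisfies condition $(\Delta)_h$ if there exist $\varepsilon\in(0,1)$ and $r_0>0$ such that $w_{a,r}(z)\le1-\varepsilon$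 for every $a\in\partial\Omega$, $r\in(0,r_0)$ and $z\in\Omega\cap\partial D(a,h(r))$. $\Omega$ satisfies $(\Delta)_{1,\alpha}$ (resp. $(\Delta)_{2,\beta}$) if there exists $C>0$ such that $\Omega$ satisfies $(\Delta)_{Ch_{1,\alpha}}$ (resp. $(\Delta)_{Ch_{2,\beta}}$). *)

(* Defs.v *)
(* The complex plane C is modelled as R * R
   (product topology = Euclidean topology) over an arbitrary realType R. *)
From HB Require Import structures.
From mathcomp Require Import all_boot all_order all_algebra.
From mathcomp Require Import all_classical all_reals all_analysis.
Set Implicit Arguments. Unset Strict Implicit. Unset Printing Implicit Defensive.
Import Order.TTheory GRing.Theory Num.Theory.
Import numFieldNormedType.Exports.
Local Open Scope classical_set_scope.
Local Open Scope ring_scope.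

Section Defs.
Variable R : realType.
Notation P := (R * R)%type.

Definition cdist (z w : P) : R :=
  Num.sqrt ((z.1 - w.1) ^+ 2 + (z.2 - w.2) ^+ 2).

Definition odisk (a : P) (r : R) : set P := [set z | cdist z a < r].
Definition circle (a : P) (r : R) : set P := [set z | cdist z a = r].

Definition bdry (A : set P) : set P := closure A `\` interior A.

Definition domain (O : set P) : Prop := O !=set0 /\ open O /\ connected O.

Definition circ_pt (z : P) (rho t : R) : P :=
  (z.1 + rho * cos t, z.2 + rho * sin t).

Definition lsc_on (G : set P) (v : P -> R) : Prop :=
  forall z, G z -> forall c, c < v z -> \forall w \near z, c < v w.

Definition supermean_on (G : set P) (v : P -> R) : Prop :=
  forall z rho, 0 < rho -> (forall w, cdist w z <= rho -> G w) ->
  (\int[@lebesgue_measure R]_(t in `[0%R, (2 * pi)%R]) (v (circ_pt z rho t))%:E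
     <= ((2 * pi)%R * v z)%:E)%E.

Definition superharmonic_on (G : set P) (v : P -> R) : Prop :=
  lsc_on G v /\ supermean_on G v.

Definition upper_perron (G : set P) (f : P -> R) : set (P -> R) :=
  [set v | [/\ superharmonic_on G v,
              (exists m, forall z, G z -> m <= v z) &
              forall zeta, bdry G zeta -> forall c, c < f zeta ->
                \forall w \near zeta, G w -> c < v w]].

Definition harm_measure (G E : set P) (z : P) : R :=
  inf [set v z | v in upper_perron G (fun zeta => if `[< E zeta >] then 1 else 0)].

(* w_{a,r}: harmonic measure of Omega ∩ ∂D(a,r) relative to Omega ∩ D(a,r);
   extended by its boundary value 1 on Omega ∩ ∂D(a,r) and by 0 elsewhere. *)
Definition w_ar (O : set P) (a : P) (r : R) (z : P) : R :=
  let G := O `&` odisk a r in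
  let E := O `&` circle a r in
  if `[< G z >] then harm_measure G E z
  else if `[< E z >] then 1 else 0.

Definition h_unif_perfect (h : R -> R) (r0 : R) (K : set P) : Prop :=
  forall a, K a -> forall r, 0 < r < r0 ->
    exists z, K z /\ h r <= cdist z a <= r.

Definition h1 (alpha : R) (r : R) : R := r `^ alpha.
Definition h2 (beta : R) (r : R) : R := r * (ln (1 / r)) `^ (- beta).

Definition condU (h : R -> R) (K : set P) : Prop :=
  exists C r0, 0 < C /\ 0 < r0 /\ closed K /\ h_unif_perfect (fun r => C * h r) r0 K.

Definition condDelta_h (h : R -> R) (O : set P) : Prop :=
  exists eps r0, 0 < eps < 1 /\ 0 < r0 /\
    forall a, bdry O a -> forall r, 0 < r < r0 ->
      forall z, O z -> cdist z a = h r -> w_ar O a r z <= 1 - eps.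

Definition condDelta (h : R -> R) (O : set P) : Prop :=
  exists C, 0 < C /\ condDelta_h (fun r => C * h r) O.

End Defs.

(* Main.v *)
(** Superharmonic competitors are compared with logarithmic potentials.

    From Delta to U: if the annulus [s <= |z - a| <= r] misses the boundary, the
    minimum principle gives [w_ar >= ln (|z - a| / s) / ln (r / s)] in
    [Omega]; for [s] much smaller than [h r] this exceeds [1 - eps] on the
    circle of radius [h r], which [Omega] meets by connectedness.

    From U to Delta: iterating the choice of a companion at distance between
    [8 g r] and [r] yields a Cantor set in the boundary, whose equidistributed measure has
    a potential bounded by [M r] as soon as [- ln (g r) + M (g r) <= 2 * M r].
    For [g r = r ^ al] one can take [M] proportional to [- ln r] exactly when
    [al < 2]; for [g r = r (- ln r) ^ (- be)], [M r = - ln r + 4 be ln (- ln r)]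
    works. The normalised potential is then a competitor that is at most
    [1 - eps] on the small circle.

    The mean value property of [ln |z - w|] follows from
    [|b + r e^it| |b - r e^it| = |b^2 - r^2 e^2it|]: the defect of the pair
    [(b, r)] is half that of [(b^2, - r^2)], and it stays bounded. *)
Require Import Defs.
From HB Require Import structures.
From mathcomp Require Import all_boot all_order all_algebra.
From mathcomp Require Import all_classical all_reals all_analysis.
From mathcomp Require Import ring lra.
Import Order.TTheory GRing.Theory Num.Theory.
Import numFieldNormedType.Exports.
Local Open Scope classical_set_scope.
Local Open Scope ring_scope.
Set Implicit Arguments.
Unset Strict Implicit.
Unset Printing Implicit Defensive.

(** Replaces passages to the limit: an estimate known at every level [n] up to an error of order
    [2 ^- n] holds without error. A positive [x] is refuted by any [n > c / x], because
    [n < 2 ^ n]. *)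
Lemma le_geometric_le0 (R : realType) (x c : R) : (forall n, x <= c / 2 ^+ n) -> x <= 0.
Proof.
move=> H; rewrite leNgt; apply/negP => x0.
pose n := (Num.truncn (c / x)).+1; have := H n.
have nc : c / x < n%:R by exact: truncnS_gt.
rewrite ler_pdivlMr ?exprn_gt0// mulrC -ler_pdivlMr// leNgt => /negP; apply.
by apply: (lt_le_trans nc); rewrite -natrX ler_nat ltnW// ltn_expl.
Qed.

(** * Integrals over a full turn of the circle *)

Section CircleIntegral.
Variable R : realType.
Notation mu := (@lebesgue_measure R).

Lemma continuous_integrable_segment (g : R -> R) (a b : R) :
  continuous g -> mu.-integrable `[a, b] (EFin \o g).
Proof.
move=> cg; apply: continuous_compact_integrable; first exact: segment_compact.
exact: continuous_subspaceT.
Qed.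

Lemma Rintegral_affine (G : R -> R) (a b k c : R) : a <= b -> 0 < k ->
  continuous G ->
  (\int[mu]_(x in `[k * a + c, k * b + c]) G x =
   k * \int[mu]_(x in `[a, b]) G (k * x + c))%R.
Proof.
move=> ab k0 cG; set F := fun x : R => k * x + c.
have dF x : is_derive x (1 : R) F k.
  by rewrite /F; apply: is_derive_eq; rewrite addr0 scaler1.
have F'E : derive1 F = cst k.
  by apply/funext => x; rewrite derive1E; apply: derive_val.
have cF : continuous F.
  move=> x; apply: differentiable_continuous; apply/derivable1_diffP.
  exact: ex_derive.
have cGF : continuous (G \o F).
  by move=> x; apply: continuous_comp; [exact: cF|exact: cG].
rewrite -RintegralZl//; last exact: continuous_integrable_segment.
rewrite /Rintegral (@integration_by_substitution_increasing _ F G a b)//.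
- congr fine; apply: eq_integral => x _; rewrite F'E /= mulrC//.
- by move=> x y _ _ xy; rewrite /F ltrD2r ltr_pM2l.
- by rewrite F'E => x _; apply: cst_continuous.
- by rewrite F'E; apply: is_cvg_cst.
- by rewrite F'E; apply: is_cvg_cst.
- split.
  + by move=> x _; apply: ex_derive.
  + by apply: cvg_at_right_filter; apply: cF.
  + by apply: cvg_at_left_filter; apply: cF.
- exact: continuous_subspaceT.
Qed.

(** Antipodal parameters are paired: the half turn over [[pi, 2 * pi]] is shifted onto [[0, pi]],
    and the substitution [2 * t] stretches that half turn back to a full one. *)
Lemma Rintegral_circle_double (g G : R -> R) : continuous g -> continuous G ->
  (forall t, g t + g (t + pi) = G (2 * t)) ->
  (\int[mu]_(t in `[0, 2 * pi]) g t =
   2^-1 * \int[mu]_(t in `[0, 2 * pi]) G t)%R.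
Proof.
move=> cg cG gG.
have pi0 := pi_gt0 R.
have -> : (\int[mu]_(t in `[0, 2 * pi]) G t =
   2 * \int[mu]_(t in `[0, pi]) G (2 * t))%R.
  have := @Rintegral_affine G 0 pi 2 0 (ltW pi0) ltac:(by []) cG.
  rewrite mulr0 !addr0 => ->; congr (_ * _); apply: eq_Rintegral => x _.
  by rewrite addr0.
rewrite mulKf//.
have Hs := @Rintegral_affine g 0 pi 1 pi (ltW pi0) ltac:(by []) cg.
have cgs : continuous (fun t => g (t + pi)).
  move=> x; apply: continuous_comp; last exact: cg.
  by apply: cvgD; [exact: cvg_id|exact: cvg_cst].
transitivity (\int[mu]_(t in `[0, pi]) g t +
              \int[mu]_(t in `[0, pi]) g (t + pi))%R.
  have -> : (\int[mu]_(t in `[0, pi]) g (t + pi) =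
             \int[mu]_(t in `[pi, 2 * pi]) g t)%R.
    have := Hs; rewrite !mul1r add0r => H2.
    rewrite mulr_natl mulr2n H2; apply: eq_Rintegral => x _.
    by rewrite mul1r.
  have H := @Rintegral_itvB _ g (BLeft 0) (BRight (2 * pi)) pi
    (continuous_integrable_segment _ _ cg).
  apply/eqP; rewrite addrC -subr_eq; apply/eqP.
  rewrite H ?bnd_simp; [|exact: ltW|lra].
  rewrite Rintegral_itv_obnd_cbnd//.
  apply: integrableS (continuous_integrable_segment pi (2 * pi) cg) => //.
  by apply: subset_itvr; rewrite bnd_simp.
have i1 := continuous_integrable_segment 0 pi cg.
have i2 := continuous_integrable_segment 0 pi cgs.
by rewrite /= -(RintegralD _ i1 i2)//; apply: eq_Rintegral => x _.
Qed.

End CircleIntegral.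

(** * The mean value property of the logarithm *)

Section LogMean.
Variable R : realType.
Notation mu := (@lebesgue_measure R).
Implicit Types (b : R * R) (rho q t : R).

Let nsq b : R := b.1 ^+ 2 + b.2 ^+ 2.

(* [|b + rho e^(it)|^2] *)
Let csq b rho t : R := (b.1 + rho * cos t) ^+ 2 + (b.2 + rho * sin t) ^+ 2.

(* the complex square of [b] *)
Let sq b : R * R := (b.1 ^+ 2 - b.2 ^+ 2, 2 * b.1 * b.2).

Let nsq_sq b : nsq (sq b) = nsq b ^+ 2.
Proof. rewrite /nsq /sq /=; ring. Qed.

Let csq_double b rho t :
  csq b rho t * csq b rho (t + pi) = csq (sq b) (- rho ^+ 2) (2 * t).
Proof.
rewrite /csq /sq /= cosDpi sinDpi mulr_natl mulr2n cosD sinD; ring.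
Qed.

(** The triangle inequality [(1 - q) |b| <= |b + rho e^(it)| <= 2 |b|] for [|rho| <= q |b|], squared
    so that no root appears. *)
Let csq_bounds b rho q t : 0 < q < 1 -> rho ^+ 2 <= q ^+ 2 * nsq b ->
  (1 - q) ^+ 2 * nsq b <= csq b rho t <= 4 * nsq b.
Proof.
move=> /andP[q0 q1] H; have E := cos2Dsin2 t.
set be := b.1 * cos t + b.2 * sin t.
have csqE : csq b rho t = nsq b + 2 * rho * be + rho ^+ 2.
  rewrite -[rho ^+ 2 in RHS]mulr1 -[X in rho ^+ 2 * X]E /csq /nsq /be; ring.
have nb : 0 <= nsq b by rewrite addr_ge0// sqr_ge0.
(* The cross term [2 * rho * be] is bounded from below by [|q b + rho e^(it)|^2 >= 0], and from
   above in [s2] by [|b - rho e^(it)|^2 >= 0]. *)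
have s1 : 0 <= q ^+ 2 * nsq b + 2 * q * rho * be + rho ^+ 2.
  suff -> : q ^+ 2 * nsq b + 2 * q * rho * be + rho ^+ 2 =
    (q * b.1 + rho * cos t) ^+ 2 + (q * b.2 + rho * sin t) ^+ 2.
    by rewrite addr_ge0// sqr_ge0.
  rewrite -[rho ^+ 2 in LHS]mulr1 -[X in rho ^+ 2 * X]E /nsq /be; ring.
have s2 : 0 <= nsq b - 2 * rho * be + rho ^+ 2.
  suff -> : nsq b - 2 * rho * be + rho ^+ 2 =
    (b.1 - rho * cos t) ^+ 2 + (b.2 - rho * sin t) ^+ 2.
    by rewrite addr_ge0// sqr_ge0.
  rewrite -[rho ^+ 2 in LHS]mulr1 -[X in rho ^+ 2 * X]E /nsq /be; ring.
have rn : rho ^+ 2 <= nsq b.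
  apply: (le_trans H); rewrite ler_piMl// expr_le1// ltW//.
apply/andP; split; last by rewrite csqE; lra.
rewrite csqE -(ler_pM2l q0).
have : 0 <= (1 - q) * (q ^+ 2 * nsq b - rho ^+ 2).
  by rewrite mulr_ge0 ?subr_ge0// ltW.
nra.
Qed.


Let csq_gt0 b rho t : rho ^+ 2 < nsq b -> 0 < csq b rho t.
Proof.
move=> H.
have nb : 0 < nsq b by rewrite (le_lt_trans _ H)// sqr_ge0.
set x := rho ^+ 2 / nsq b.
have x1 : 0 <= x < 1 by rewrite /x divr_ge0 ?sqr_ge0 ?ltW//= ltr_pdivrMr// mul1r.
(* The ratio [q = (1 + x) / 2] lies strictly between 0 and 1, and [x <= q ^+ 2] by the
   arithmetic-geometric mean inequality. *)
have /andP[+ _] := @csq_bounds b rho ((1 + x) / 2) t ltac:(lra) ltac:(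
  rewrite -ler_pdivrMr// -/x; nra).
by apply: lt_le_trans; rewrite mulr_gt0// exprn_gt0//; lra.
Qed.

Let continuous_ln_csq b rho : rho ^+ 2 < nsq b ->
  continuous (fun t => ln (csq b rho t)).
Proof.
move=> H t; apply: continuous_comp; last exact/continuous_ln/csq_gt0.
have c1 : continuous (fun t => b.1 + rho * cos t).
  move=> u; apply: cvgD; first exact: cvg_cst.
  by apply: cvgM; [exact: cvg_cst|exact: continuous_cos].
have c2 : continuous (fun t => b.2 + rho * sin t).
  move=> u; apply: cvgD; first exact: cvg_cst.
  by apply: cvgM; [exact: cvg_cst|exact: continuous_sin].
suff : csq b rho x @[x --> t] --> csq b rho t by [].
rewrite /csq; apply: cvgD; rewrite expr2; under eq_fun do rewrite expr2.
  by apply: cvgM; exact: c1.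
by apply: cvgM; exact: c2.
Qed.

Let J b rho : R := (\int[mu]_(t in `[0%R, 2 * pi]) ln (csq b rho t))%R.

Let nsq_sq_gt b rho : rho ^+ 2 < nsq b -> (- rho ^+ 2) ^+ 2 < nsq (sq b).
Proof.
move=> H; rewrite nsq_sq sqrrN.
by rewrite ltr_pXn2r// nnegrE ?sqr_ge0// ltW// (le_lt_trans _ H)// sqr_ge0.
Qed.

Let J_double b rho : rho ^+ 2 < nsq b ->
  J b rho = 2^-1 * J (sq b) (- rho ^+ 2).
Proof.
move=> H; apply: Rintegral_circle_double.
- exact: continuous_ln_csq.
- exact/continuous_ln_csq/nsq_sq_gt.
- by move=> t; rewrite -csq_double lnM// posrE csq_gt0.
Qed.

Lemma Rintegral_circle_cst (c : R) :
  (\int[mu]_(t in `[0, 2 * pi]) c)%R = 2 * pi * c.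
Proof.
rewrite Rintegral_cst//= lebesgue_measure_itv/= lte_fin.
by rewrite ifT ?mulr_gt0// ?pi_gt0// oppr0 addr0/= mulrC.
Qed.

Lemma le_Rintegral_circle (f g : R -> R) : continuous f -> continuous g ->
  (forall t, f t <= g t) ->
  (\int[mu]_(t in `[0, 2 * pi]) f t <= \int[mu]_(t in `[0, 2 * pi]) g t)%R.
Proof.
move=> cf cg fg; apply: le_Rintegral => //; try exact: continuous_integrable_segment.
Qed.

Let J_bound b rho q : 0 < q < 1 -> 0 < nsq b -> rho ^+ 2 <= q ^+ 2 * nsq b ->
  `|J b rho - 2 * pi * ln (nsq b)| <= 2 * pi * (ln 4 - ln ((1 - q) ^+ 2)).
Proof.
move=> q01 nb H.
have H' : rho ^+ 2 < nsq b.
  by apply: (le_lt_trans H); rewrite gtr_pMl// expr_lt1//; lra.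
have q0 : 0 < (1 - q) ^+ 2 by rewrite exprn_gt0//; lra.
have l4 : 0 <= ln (4 : R) by rewrite ln_ge0//; lra.
have lq : ln ((1 - q) ^+ 2) <= 0 by rewrite ln_le0// expr_le1//; lra.
have pi0 := pi_gt0 R.
have p4 : 0 <= pi * ln (4 : R) by rewrite mulr_ge0// ltW.
have pq : pi * ln ((1 - q) ^+ 2) <= 0 by rewrite mulr_ge0_le0// ltW.
have cc (c : R) : continuous (fun _ : R => c) by move=> x; exact: cvg_cst.
rewrite ler_norml; apply/andP; split.
- apply: (@le_trans _ _ (2 * pi * ln ((1 - q) ^+ 2 * nsq b) - 2 * pi * ln (nsq b))).
    have -> : ln ((1 - q) ^+ 2 * nsq b) = ln ((1 - q) ^+ 2) + ln (nsq b).
      by apply: lnM; rewrite posrE.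
    lra.
  rewrite lerD2r -Rintegral_circle_cst; apply: le_Rintegral_circle => //.
    exact: continuous_ln_csq.
  move=> t; rewrite ler_ln ?posrE ?(mulr_gt0 q0 nb) ?csq_gt0//.
  by have /andP[] := csq_bounds t q01 H.
- apply: (@le_trans _ _ (2 * pi * ln (4 * nsq b) - 2 * pi * ln (nsq b))); last first.
    have -> : ln (4 * nsq b) = ln 4 + ln (nsq b) by apply: lnM; rewrite posrE.
    lra.
  rewrite lerD2r -Rintegral_circle_cst; apply: le_Rintegral_circle => //.
    exact: continuous_ln_csq.
  move=> t; rewrite ler_ln ?posrE ?mulr_gt0 ?csq_gt0//.
  by have /andP[] := csq_bounds t q01 H.
Qed.

(** Passing from [(b, rho)] to [(sq b, - rho ^+ 2)] doubles the defect exactly and improves the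
    ratio [q] to [q ^+ 2 <= q]. The bound of [J_bound] thus still applies, with the same constant,
    after [n] squarings. *)
Let J_iter_bound n b rho q : 0 < q < 1 -> 0 < nsq b ->
  rho ^+ 2 <= q ^+ 2 * nsq b ->
  `|J b rho - 2 * pi * ln (nsq b)| * 2 ^+ n
    <= 2 * pi * (ln 4 - ln ((1 - q) ^+ 2)).
Proof.
move=> q01; elim: n b rho => [|n IH] b rho nb H.
  by rewrite mulr1; exact: J_bound.
have q2 : 0 < q ^+ 2 < 1 by rewrite exprn_gt0 ?expr_lt1//; lra.
have H' : rho ^+ 2 < nsq b by apply: (le_lt_trans H); rewrite gtr_pMl//; lra.
apply: le_trans (IH (sq b) (- rho ^+ 2) _ _); last 2 first.
- by rewrite nsq_sq exprn_gt0.
- rewrite nsq_sq sqrrN.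
  apply: (@le_trans _ _ ((q ^+ 2 * nsq b) ^+ 2)).
    by rewrite ler_pXn2r// nnegrE ?sqr_ge0// mulr_ge0// ?sqr_ge0// ltW.
  rewrite exprMn ler_wpM2r ?sqr_ge0//; nra.
rewrite (J_double H') [2 ^+ n.+1]exprS mulrA ler_pM2r ?exprn_gt0//.
rewrite nsq_sq lnXn// -[X in _ * X <= _](ger0_norm (ler0n R 2)) -normrM.
rewrite le_eqVlt; apply/orP; left; apply/eqP; congr (`|_|).
by field.
Qed.

Let J_eq b rho : rho ^+ 2 < nsq b -> J b rho = 2 * pi * ln (nsq b).
Proof.
move=> H.
have nb : 0 < nsq b by rewrite (le_lt_trans _ H)// sqr_ge0.
set x := rho ^+ 2 / nsq b.
have x1 : 0 <= x < 1 by rewrite /x divr_ge0 ?sqr_ge0 ?ltW//= ltr_pdivrMr// mul1r.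
have B n := @J_iter_bound n b rho ((1 + x) / 2) ltac:(lra) nb ltac:(
  rewrite -ler_pdivrMr// -/x; nra).
apply/eqP; rewrite -subr_eq0 -normr_le0; apply: le_geometric_le0 => n.
by rewrite ler_pdivlMr ?exprn_gt0//; exact: B.
Qed.

Lemma ln_cdist (z w : R * R) : z <> w ->
  ln (cdist z w) = 2^-1 * ln ((z.1 - w.1) ^+ 2 + (z.2 - w.2) ^+ 2).
Proof.
move=> zw; rewrite /cdist; set x := _ + _.
have x0 : 0 < x.
  rewrite lt_neqAle eq_sym addr_ge0 ?sqr_ge0// andbT.
  rewrite paddr_eq0 ?sqr_ge0// !sqrf_eq0 !subr_eq0.
  apply/negP => /andP[/eqP e1 /eqP e2]; apply: zw.
  by case: z w e1 e2 {x} => ? ? [? ?] /= -> ->.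
by rewrite -[X in _ = _ * ln X](sqr_sqrtr (ltW x0)) lnXn ?sqrtr_gt0// -[ln _ *+ 2]mulr_natl mulKf.
Qed.

Lemma mean_ln_cdist (z w : R * R) rho : rho ^+ 2 < cdist z w ^+ 2 ->
  (\int[mu]_(t in `[0, 2 * pi]) ln (cdist (circ_pt z rho t) w))%R =
  2 * pi * ln (cdist z w).
Proof.
move=> H; set b := (z.1 - w.1, z.2 - w.2).
have Hb : rho ^+ 2 < nsq b.
  by move: H; rewrite /cdist sqr_sqrtr// addr_ge0// sqr_ge0.
have csqE t : csq b rho t =
   ((circ_pt z rho t).1 - w.1) ^+ 2 + ((circ_pt z rho t).2 - w.2) ^+ 2.
  by rewrite /csq /circ_pt /=; congr (_ ^+ 2 + _ ^+ 2); ring.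
rewrite (_ : (fun t => _) = fun t => 2^-1 * ln (csq b rho t)); last first.
  apply/funext => t; rewrite ln_cdist -?csqE// => e.
  by have := csq_gt0 t Hb; rewrite csqE e !subrr expr0n addr0 ltxx.
rewrite RintegralZl//; last exact/continuous_integrable_segment/continuous_ln_csq.
rewrite -/(J b rho) J_eq// ln_cdist; first by rewrite -/(nsq b); ring.
by move=> e; move: Hb; rewrite /b e /nsq /= !subrr expr0n addr0 ltNge sqr_ge0.
Qed.

End LogMean.

(** * Euclidean distance and harmonic functions in the plane *)

Section Plane.
Variable R : realType.
Notation P := (R * R)%type.
Notation mu := (@lebesgue_measure R).
Implicit Types (z w a x : P) (r rho t : R).

Lemma cdist_ge0 z w : 0 <= cdist z w.
Proof. exact: sqrtr_ge0. Qed.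

Lemma sqr_cdist z w :
  cdist z w ^+ 2 = (z.1 - w.1) ^+ 2 + (z.2 - w.2) ^+ 2.
Proof. by rewrite /cdist sqr_sqrtr// addr_ge0// sqr_ge0. Qed.

Lemma cdistC z w : cdist z w = cdist w z.
Proof. by rewrite /cdist; congr Num.sqrt; ring. Qed.

Lemma cdistxx z : cdist z z = 0.
Proof. by rewrite /cdist !subrr expr0n addr0 sqrtr0. Qed.

Lemma cdist_gt0 z w : z <> w -> 0 < cdist z w.
Proof.
move=> zw; rewrite lt_neqAle cdist_ge0 andbT eq_sym; apply/negP => /eqP d0.
apply: zw; have := sqr_cdist z w; rewrite d0 expr0n/= => /esym/eqP.
rewrite paddr_eq0 ?sqr_ge0// !sqrf_eq0 !subr_eq0 => /andP[/eqP e1 /eqP e2].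
by case: z w e1 e2 d0 => ? ? [? ?] /= -> ->.
Qed.

Lemma cdist_triangle x z w : cdist z w <= cdist z x + cdist x w.
Proof.
have := sqr_cdist z w; have := sqr_cdist z x; have := sqr_cdist x w.
have := cdist_ge0 z w; have := cdist_ge0 z x; have := cdist_ge0 x w.
set A := cdist z x; set B := cdist x w; set C := cdist z w.
set a1 := z.1 - x.1; set a2 := z.2 - x.2; set b1 := x.1 - w.1.
set b2 := x.2 - w.2 => B0 A0 C0 EB EA.
have -> : z.1 - w.1 = a1 + b1 by rewrite /a1 /b1; ring.
have -> : z.2 - w.2 = a2 + b2 by rewrite /a2 /b2; ring.
move=> EC.
(* Cauchy-Schwarz, from the Lagrange identity: the difference of the two squares is
   [(a1 * b2 - a2 * b1) ^+ 2]. *)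
have CS : a1 * b1 + a2 * b2 <= A * B.
  apply: le_trans (ler_norm _) _.
  rewrite -ler_sqr ?nnegrE ?mulr_ge0// -normrX ger0_norm ?sqr_ge0// exprMn EA EB.
  have := sqr_ge0 (a1 * b2 - a2 * b1); nra.
rewrite -ler_sqr ?nnegrE ?addr_ge0// EC.
nra.
Qed.

Lemma cdist_circ_pt z rho t : 0 <= rho -> cdist (circ_pt z rho t) z = rho.
Proof.
move=> rho0; apply/eqP; rewrite -(eqrXn2 (n := 2))// ?cdist_ge0//; apply/eqP.
rewrite sqr_cdist /circ_pt /= -[RHS]mulr1 -[X in _ = _ * X](cos2Dsin2 t); ring.
Qed.

Lemma continuous_cdist a : continuous (fun w => cdist w a).
Proof.
move=> z; apply: continuous_comp; last exact: sqrt_continuous.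
apply: cvgD; under eq_fun do rewrite expr2; rewrite expr2; apply: cvgM;
  apply: cvgB; try exact: cvg_cst; solve [exact: cvg_fst | exact: cvg_snd].
Qed.

Lemma near_cdist z (e : R) : 0 < e -> \forall w \near z, cdist w z < e.
Proof.
move=> e0; have : cdist w z @[w --> z] --> (0 : R).
  by rewrite -[X in _ --> X](cdistxx z); exact: continuous_cdist.
by move/cvgr_lt; exact.
Qed.

(** The balls of the product topology are squares; the Euclidean disk of radius [e] lies in the
    square of half-side [e]. *)
Lemma nbhs_cdist z (A : set P) : nbhs z A ->
  exists2 e : R, 0 < e & forall w, cdist w z < e -> A w.
Proof.
move=> /nbhs_ballP[e /= e0 zA]; exists e => // w wz; apply: zA.
have H (y y' : R) : (y - y') ^+ 2 <= cdist w z ^+ 2 -> ball y' e y.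
  move=> H; rewrite /ball /= distrC; apply: le_lt_trans wz.
  by rewrite -ler_sqr ?nnegrE ?cdist_ge0// -normrX ger0_norm ?sqr_ge0//.
by split; apply: H; rewrite sqr_cdist ?lerDl ?lerDr sqr_ge0.
Qed.

Lemma continuous_circ_pt z rho : continuous (circ_pt z rho).
Proof.
move=> t.
suff : (z.1 + rho * cos x, z.2 + rho * sin x) @[x --> t] -->
  (z.1 + rho * cos t, z.2 + rho * sin t) by [].
apply: (@cvg_pair _ _ _ _ (nbhs _) (nbhs _)) => /=; apply: cvgD; try exact: cvg_cst;
  apply: cvgM; try exact: cvg_cst.
- exact: continuous_cos.
- exact: continuous_sin.
Qed.

Lemma compact_closed_disk z r : compact [set w | cdist w z <= r].
Proof.
apply: (@subclosed_compact _ _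
  (`[z.1 - r, z.1 + r]%classic `*` `[z.2 - r, z.2 + r]%classic)).
- apply: (@closed_comp _ _ (fun w => cdist w z) [set s | s <= r]).
    by move=> w _; exact: continuous_cdist.
  exact: closed_le.
- by apply: compact_setX; exact: segment_compact.
- move=> w /= wr; have r0 : 0 <= r by apply: le_trans wr; exact: cdist_ge0.
  have H (y y' : R) : (y - y') ^+ 2 <= cdist w z ^+ 2 ->
      y \in `[y' - r, y' + r].
    move=> H; rewrite in_itv /= -ler_distl; apply: le_trans wr.
    by rewrite -ler_sqr ?nnegrE ?cdist_ge0// -normrX ger0_norm ?sqr_ge0//.
  by split; apply: H; rewrite sqr_cdist ?lerDl ?lerDr sqr_ge0.
Qed.

(** Harmonicity without derivatives. The form is stable under linear combinations and under uniform
    limits, the only operations performed below. *)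
Definition mean_value_on (G : set P) (u : P -> R) : Prop :=
  (forall z, G z -> {for z, continuous u}) /\
  (forall z rho, 0 < rho -> (forall w, cdist w z <= rho -> G w) ->
    (\int[mu]_(t in `[0%R, 2 * pi]) u (circ_pt z rho t))%R = 2 * pi * u z).

Lemma continuous_on_circle (G : set P) (u : P -> R) z rho : 0 < rho ->
  (forall x, G x -> {for x, continuous u}) ->
  (forall w, cdist w z <= rho -> G w) -> continuous (fun t => u (circ_pt z rho t)).
Proof.
move=> rho0 cu dG t; apply: continuous_comp; first exact: continuous_circ_pt.
by apply: cu; apply: dG; rewrite cdist_circ_pt// ltW.
Qed.

Lemma integral_circleE (g : R -> R) : continuous g ->
  (\int[mu]_(t in `[0%R, (2 * pi)%R]) (g t)%:E)%E =
  ((\int[mu]_(t in `[0, 2 * pi]) g t)%R)%:E.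
Proof.
by move=> cg; rewrite /Rintegral fineK// integrable_fin_num//;
  exact: continuous_integrable_segment.
Qed.

Lemma mean_value_superharmonic (G : set P) (u : P -> R) :
  mean_value_on G u -> superharmonic_on G u.
Proof.
move=> [cu mu_]; split.
  by move=> z Gz c cz; apply: (cvgr_gt _ (cu z Gz)).
move=> z rho rho0 dG; rewrite integral_circleE ?mu_//.
exact: continuous_on_circle rho0 cu dG.
Qed.

Lemma mean_value_cst (G : set P) (c : R) : mean_value_on G (fun=> c).
Proof.
split=> [z _|z rho _ _]; first exact: cvg_cst.
by rewrite Rintegral_circle_cst.
Qed.

Lemma mean_value_lin (G : set P) (u v : P -> R) (k l : R) :
  mean_value_on G u -> mean_value_on G v ->
  mean_value_on G (fun z => k * u z + l * v z).
Proof.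
move=> [cu mu_] [cv mv]; split=> [z Gz|z rho rho0 dG].
  by apply: cvgD; apply: cvgM; try exact: cvg_cst; [exact: cu|exact: cv].
have i1 := continuous_on_circle rho0 cu dG.
have i2 := continuous_on_circle rho0 cv dG.
have I1 := continuous_integrable_segment 0 (2 * pi) i1.
have I2 := continuous_integrable_segment 0 (2 * pi) i2.
have ck (h : R -> R) (c : R) : continuous h -> continuous (fun t => c * h t).
  by move=> ch t; apply: cvgM; [exact: cvg_cst|exact: ch].
rewrite RintegralD//; last 2 first.
- exact/continuous_integrable_segment/ck.
- exact/continuous_integrable_segment/ck.
rewrite !RintegralZl// mu_// mv//; ring.
Qed.

Lemma mean_value_ln_cdist (G : set P) a : ~ G a ->
  mean_value_on G (fun z => ln (cdist z a)).
Proof.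
move=> Ga; split=> [z Gz|z rho rho0 dG].
  apply: continuous_comp; first exact: continuous_cdist.
  by apply/continuous_ln/cdist_gt0 => e; apply: Ga; rewrite -e.
apply: mean_ln_cdist; rewrite ltr_pXn2r// ?nnegrE ?cdist_ge0 ?ltW//.
by rewrite ltNge; apply/negP => H; apply: Ga; apply: dG; rewrite cdistC.
Qed.

(** By the parallelogram law, antipodal points contribute a constant. The excess [rho ^+ 2] over the
    value at the centre makes the perturbation in [minimum_principle] strict. *)
Lemma mean_sqr_cdist z a rho :
  (\int[mu]_(t in `[0%R, 2 * pi]) (cdist (circ_pt z rho t) a ^+ 2))%R =
  2 * pi * (cdist z a ^+ 2 + rho ^+ 2).
Proof.
rewrite (@Rintegral_circle_double _ _
  (fun=> 2 * (cdist z a ^+ 2 + rho ^+ 2))).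
- by rewrite Rintegral_circle_cst; field.
- have cc : continuous (fun t => cdist (circ_pt z rho t) a).
    by move=> t; apply: (@continuous_comp _ _ _ (circ_pt z rho) (fun w => cdist w a));
      [exact: continuous_circ_pt|exact: continuous_cdist].
  move=> t; under eq_fun do rewrite expr2; apply: cvgM;
    exact: cc.
- by move=> t; exact: cvg_cst.
- move=> t; rewrite !sqr_cdist /circ_pt /= cosDpi sinDpi.
  rewrite -[rho ^+ 2]mulr1 -[X in rho ^+ 2 * X](cos2Dsin2 t); ring.
Qed.

End Plane.

(* Monotonicity of the integral holds for all functions, measurable or not,
   since the integral of a nonnegative function is a supremum over the simple
   functions below it. *)
Lemma le_integral_total d (T : measurableType d) (R : realType)
    (m : {measure set T -> \bar R}) (D : set T) (f g : T -> \bar R) :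
  (forall x, D x -> (f x <= g x)%E) ->
  (\int[m]_(x in D) f x <= \int[m]_(x in D) g x)%E.
Proof.
move=> fg; rewrite !(integral_mkcond D).
have {}fg x : ((f \_ D) x <= (g \_ D) x)%E.
  by rewrite /patch; case: ifPn => // /set_mem; exact: fg.
rewrite integralE [leRHS]integralE leeB//.
- rewrite !ge0_integralTE//; apply: ereal_sup_le => _ [h /= hf <-].
  by exists h => //= x; apply: (le_trans (hf x)); apply: (@funepos_le _ _ setT);
    rewrite ?inE// => y _; exact: fg.
- rewrite !ge0_integralTE//; apply: ereal_sup_le => _ [h /= hf <-].
  by exists h => //= x; apply: (le_trans (hf x)); apply: (@funeneg_le _ _ setT);
    rewrite ?inE// => y _; exact: fg.
Qed.

(** * The minimum principle on bounded open sets *)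

Section MinimumPrinciple.
Variable R : realType.
Notation P := (R * R)%type.
Notation mu := (@lebesgue_measure R).

(** If [v - u] is negative somewhere, adding [eta * (r ^+ 2 - |w - a|^2)] leaves a negative infimum
    that cannot be attained, the added term being strictly superharmonic. Semicontinuity, the
    boundary behaviour and compactness of [closure G] show that it cannot be approached either.
    Thanks to strictness, monotonicity of the integral is all that is needed of [v]. *)
Lemma minimum_principle (G : set P) (a : P) (r : R) (v u : P -> R) :
  open G -> (forall z, G z -> cdist z a < r) ->
  superharmonic_on G v -> mean_value_on G u ->
  (exists m, forall z, G z -> m <= v z - u z) ->
  (forall zeta, bdry G zeta -> forall e, 0 < e ->
     \forall w \near zeta, G w -> u w - e < v w) ->
  forall z, G z -> u z <= v z.
Proof.
move=> oG Gr [lv sv] [cu mu_] [m mvu] bv z0 Gz0; rewrite leNgt; apply/negP => vu.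
have r0 : 0 < r by apply: le_lt_trans (Gr _ Gz0); exact: cdist_ge0.
pose d := u z0 - v z0; have d0 : 0 < d by rewrite subr_gt0.
(* The perturbation is then at most [eta * r ^+ 2 = d / 2] on [G], so that [phi z0 <= - (d / 2)]. *)
pose eta := d / (2 * r ^+ 2).
have eta0 : 0 < eta by rewrite divr_gt0// mulr_gt0// exprn_gt0.
pose q w := u w - eta * r ^+ 2 + eta * cdist w a ^+ 2.
have etar : eta * r ^+ 2 = d / 2.
  by rewrite /eta; field; rewrite gt_eqF.
have sqr_lt w : G w -> eta * cdist w a ^+ 2 <= eta * r ^+ 2.
  move=> Gw; rewrite ler_pM2l// ler_pXn2r ?nnegrE ?cdist_ge0 ?ltW//; exact: Gr.
have sqr_ge w : 0 <= eta * cdist w a ^+ 2.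
  by rewrite mulr_ge0 ?sqr_ge0// ltW.
pose phi w := v w - q w.
have phiz0 : phi z0 <= - (d / 2).
  by rewrite /phi /q etar; have := sqr_ge z0; rewrite /d; lra.
have cq z : G z -> {for z, continuous q}.
  move=> Gz; apply: cvgD; first by apply: cvgB; [exact: cu|exact: cvg_cst].
  apply: cvgM; first exact: cvg_cst.
  by under eq_fun do rewrite expr2; apply: cvgM; exact: continuous_cdist.
pose A := [set phi w | w in G].
have Ainf : has_inf A.
  split; first by exists (phi z0), z0.
  exists m => _ [w Gw <-]; have := mvu w Gw; have := sqr_lt w Gw.
  by rewrite /phi /q; lra.
have infA w : G w -> inf A <= phi w by move=> Gw; apply: ge_inf; [case: Ainf|exists w].
(* At a minimum [w0], [v >= inf A + q] on a small circle and the mean of the right-hand side is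
   [v w0 + eta * rho ^+ 2], contradicting [supermean_on]. *)
have [[w0 Gw0 phiw0]|nomin] := pselect (exists2 w, G w & phi w = inf A).
  have [e e0 eG] := nbhs_cdist (open_nbhs_nbhs (conj oG Gw0)).
  pose rho := e / 2; have rho0 : 0 < rho by rewrite divr_gt0.
  have dG w : cdist w w0 <= rho -> G w.
    by move=> wr; apply: eG; apply: (le_lt_trans wr); rewrite /rho; lra.
  have cqt := continuous_on_circle rho0 cq dG.
  have cut := continuous_on_circle rho0 cu dG.
  have cdt : continuous (fun t => cdist (circ_pt w0 rho t) a ^+ 2).
    have cc : continuous (fun t => cdist (circ_pt w0 rho t) a).
      by move=> t; apply: (@continuous_comp _ _ _ (circ_pt w0 rho) (fun w => cdist w a));
        [exact: continuous_circ_pt|exact: continuous_cdist].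
    by move=> t; under eq_fun do rewrite expr2; apply: cvgM; exact: cc.
  have cst_c (c : R) : continuous (fun _ : R => c) by move=> t; exact: cvg_cst.
  have cF : continuous (fun t => inf A + q (circ_pt w0 rho t)).
    by move=> t; apply: cvgD; [exact: cvg_cst|exact: cqt].
  have := sv w0 rho rho0 dG; rewrite leNgt => /negP; apply.
  apply: (@lt_le_trans _ _
    (\int[mu]_(t in `[0%R, (2 * pi)%R])
       (inf A + q (circ_pt w0 rho t))%:E)%E); last first.
    apply: le_integral_total => t _; rewrite lee_fin.
    have := infA (circ_pt w0 rho t); rewrite /phi lerBrDr; apply.
    by apply: dG; rewrite cdist_circ_pt// ltW.
  rewrite integral_circleE// lte_fin.
  rewrite (_ : (fun t => _) = (fun t => (inf A - eta * r ^+ 2) +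
    (u (circ_pt w0 rho t) + eta * cdist (circ_pt w0 rho t) a ^+ 2))); last first.
    by apply/funext => t; rewrite /q; ring.
  have c2 : continuous (fun t => eta * cdist (circ_pt w0 rho t) a ^+ 2).
    by move=> t; apply: cvgM; [exact: cvg_cst|exact: cdt].
  have c3 : continuous (fun t => u (circ_pt w0 rho t) +
                                 eta * cdist (circ_pt w0 rho t) a ^+ 2).
    by move=> t; apply: cvgD; [exact: cut|exact: c2].
  rewrite (RintegralD _ (continuous_integrable_segment 0 (2 * pi) (cst_c _))
    (continuous_integrable_segment 0 (2 * pi) c3))//.
  rewrite (RintegralD _ (continuous_integrable_segment 0 (2 * pi) cut)
    (continuous_integrable_segment 0 (2 * pi) c2))//.
  rewrite (RintegralZl _ _ (continuous_integrable_segment 0 (2 * pi) cdt))//.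
  rewrite Rintegral_circle_cst mu_// mean_sqr_cdist.
  rewrite -phiw0 /phi /q.
  have pi0 := pi_gt0 R; have rr : 0 < eta * rho ^+ 2 by rewrite mulr_gt0// exprn_gt0.
  rewrite -subr_gt0.
  apply: (@lt_le_trans _ _ (2 * (pi * (eta * rho ^+ 2)))); first by rewrite mulr_gt0// mulr_gt0.
  by rewrite le_eqVlt; apply/orP; left; apply/eqP; ring.
have phi_gt w : G w -> inf A < phi w.
  move=> Gw; rewrite lt_neqAle infA// andbT; apply/negP => /eqP e.
  by apply: nomin; exists w.
have cptG : compact (closure G).
  apply: (@subclosed_compact _ _ [set w | cdist w a <= r]).
  - exact: closed_closure.
  - exact: compact_closed_disk.
  - have := @closure_subset _ G [set w | cdist w a <= r].
    rewrite -(closure_id [set w | cdist w a <= r]).1; last first.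
      apply: (@closed_comp _ _ (fun w => cdist w a) [set s | s <= r]).
        by move=> w _; exact: continuous_cdist.
      exact: closed_le.
    by apply => w Gw; apply/ltW/Gr.
have infAd : inf A <= - (d / 2) by apply: le_trans phiz0; exact: infA.
(* Levels [c] range over a filter to the right of [inf A], so that compactness provides a single
   level above [inf A] that [phi] exceeds on all of [G]. *)
have cov x : closure G x ->
    \forall x' \near x & c \near (inf A)^'+, G x' -> c < phi x'.
  move=> Gx.
  suff [k Ak xk] : exists2 k, inf A < k & \forall x' \near x, G x' -> k < phi x'.
    exists ([set x' | G x' -> k < phi x'], [set c | c < k]).
      by split => //=; exact: nbhs_right_lt.
    by move=> [x' c] [/= h ck] Gx'; exact: (lt_trans ck (h Gx')).
  have [Gx1|Gx0] := pselect (G x).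
    (* One [de] is lost to the semicontinuity of [v] and one to the continuity of [q], which leaves
       [phi] above [inf A + 2 * de]. *)
    have [de de0 deE] : exists2 de, 0 < de & de * 4 = phi x - inf A.
      exists ((phi x - inf A) / 4); last by rewrite mulfVK.
      by rewrite divr_gt0// subr_gt0 phi_gt.
    exists (inf A + de); first by rewrite ltrDl.
    have H1 := lv x Gx1 (v x - de) ltac:(by rewrite ltrBlDr ltrDl).
    have H2 : \forall w \near x, q w < q x + de.
      by apply: (cvgr_lt _ (cq x Gx1)); rewrite ltrDl.
    near=> w => _.
    have h1 : v x - de < v w by near: w.
    have h2 : q w < q x + de by near: w.
    rewrite /phi in deE *; lra.
  (* Near the boundary [phi >= v - u > - (d / 4)], whereas [inf A <= - (d / 2)]. *)
  exists (- (d / 4)); first by lra.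
  have bx : bdry G x by split => // /interior_subset.
  have := bv x bx (d / 4) ltac:(by rewrite divr_gt0//).
  apply: filterS => w H Gw; have := H Gw; have := sqr_lt w Gw.
  rewrite /phi /q; lra.
have := (compact_near_coveringP (closure G)).1 cptG _ _
  (fun c x' => G x' -> c < phi x') _ cov.
move=> H; have [c [cA /= cc]] := filter_ex (filterI (H _) (nbhs_right_gt (inf A))).
have : c <= inf A.
  apply: lb_le_inf; first by case: Ainf.
  move=> _ [w Gw <-]; apply/ltW; apply: cA => //; exact: subset_closure.
by rewrite leNgt cc.
Unshelve. all: by end_near. Qed.

End MinimumPrinciple.

(** * From harmonic measure bounds to uniform perfectness *)

Section DeltaToUniformlyPerfect.
Variable R : realType.
Notation P := (R * R)%type.

Lemma open_odisk (a : P) (r : R) : open (odisk a r).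
Proof.
rewrite openE => z; rewrite /odisk /= => zr.
by apply: (cvgr_lt _ (@continuous_cdist R a z)).
Qed.

Lemma closure_cdist_le (A : set P) (a : P) (r : R) :
  (forall z, A z -> cdist z a <= r) -> forall z, closure A z -> cdist z a <= r.
Proof.
move=> Ar z Az; apply/ler_addgt0Pr => e e0.
have [w [Aw wz]] := Az _ (near_cdist z e0).
apply: (le_trans (cdist_triangle w z a)); rewrite addrC lerD ?Ar//.
by rewrite cdistC ltW.
Qed.

Lemma connected_meets_circle (O : set P) (a p : P) (rho : R) :
  connected O -> closure O a -> O p -> 0 < rho <= cdist p a ->
  exists2 z, O z & cdist z a = rho.
Proof.
move=> cO Oa Op /andP[rho0 rp].
have [q [Oq qa]] := Oa _ (near_cdist a rho0).
have cI : connected [set cdist z a | z in O].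
  apply: connected_continuous_connected => //.
  exact/continuous_subspaceT/continuous_cdist.
have /connected_intervalP/(_ (cdist q a) (cdist p a)) := cI.
case/(_ _ _ rho) => [| |/=|z Oz <-].
- by exists q.
- by exists p.
- by rewrite ltW// rp.
- by exists z.
Qed.

(** The normalised logarithm [u] vanishes on the inner circle and equals 1 on the outer one. Since
    the annulus is free of [bdry O], a boundary point of [G] is either inside the inner circle,
    where [u] is negative, or in [O] on the outer circle, where competitors tend to at least 1. That
    [u] tends to minus infinity at [a] is harmless: only [v - u] must be bounded below. *)
Lemma harm_measure_ge_log (O : set P) (a z : P) (r s : R) :
  open O -> bdry O a -> 0 < s < r ->
  (forall zeta, bdry O zeta -> ~ (s <= cdist zeta a <= r)) ->
  O z -> cdist z a < r ->
  (ln (cdist z a) - ln s) / (ln r - ln s) <= w_ar O a r z.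
Proof.
move=> oO bOa /andP[s0 sr] free Oz zr.
have Oa : ~ O a by move=> Oa; apply: bOa.2; exact: (open_nbhs_nbhs (conj oO Oa)).
rewrite /w_ar ifT; last exact/asboolP.
have r0 : 0 < r by exact: lt_trans sr.
have lrs : 0 < ln r - ln s by rewrite subr_gt0 ltr_ln.
set G := O `&` odisk a r.
pose u w := (ln (cdist w a) - ln s) / (ln r - ln s).
have Ga : ~ G a by case.
have u1 w : G w -> u w <= 1.
  move=> [Ow wr]; rewrite /u ler_pdivrMr// mul1r lerD2r ler_ln ?posrE ?ltW//.
  by apply: cdist_gt0 => e; apply: Oa; rewrite -e.
(* The constant 1 is a competitor, so the infimum is over a nonempty set. *)
apply: lb_le_inf.
  exists 1; exists (fun=> 1) => //; split.
  - exact/mean_value_superharmonic/mean_value_cst.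
  - by exists 1.
  - move=> zeta _ c; case: ifP => _ c1; apply: (@filterE _ (nbhs zeta)) => w _ //.
    by apply: (lt_trans c1).
move=> _ [v [shv [m mv] bv] <-].
apply: (@minimum_principle _ G a r v u) => //.
- by apply: openI => //; exact: open_odisk.
- by move=> w [].
- have := mean_value_lin (ln r - ln s)^-1 (- ln s / (ln r - ln s))
    (mean_value_ln_cdist Ga) (mean_value_cst G 1).
  by congr mean_value_on; apply/funext => w; rewrite /u; ring.
- by exists (m - 1) => w Gw; rewrite lerB ?mv// u1.
move=> zeta bz e e0.
have zr' : cdist zeta a <= r.
  apply: closure_cdist_le bz.1 => w [_]; rewrite /odisk /=; exact: ltW.
have clO : closure O zeta by apply: closure_subset bz.1 => w [].
have [zs|zs] := ltP (cdist zeta a) s.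
  have H := bv zeta bz (- e); rewrite ifF in H; last first.
    apply/asboolP => -[_]; rewrite /circle /= => zr2.
    by move: zs; rewrite zr2 ltNge ltW.
  have {}H := H ltac:(by rewrite oppr_lt0).
  have H2 : \forall w \near zeta, cdist w a < s.
    by apply: (cvgr_lt _ (@continuous_cdist R a zeta)).
  near=> w => Gw.
  have h1 : - e < v w by move: Gw; near: w.
  have h2 : cdist w a < s by near: w.
  apply: le_lt_trans h1; rewrite gerDr /u pmulr_lle0 ?invr_gt0// subr_le0 ler_ln ?posrE ?ltW//.
  by apply: cdist_gt0 => e1; apply: Ga; rewrite -e1.
(* A point of [closure O] in the free annulus belongs to [O]; being on the boundary of [G], it must
   then lie on the outer circle. *)
have Oz' : O zeta.
  apply: contrapT => nO; apply: (free zeta); last by rewrite zs.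
  by split => // /interior_subset.
have zr2 : cdist zeta a = r.
  apply/eqP; rewrite eq_le zr' /= leNgt; apply/negP => lt; apply: bz.2.
  have oG : open G by apply: openI => //; exact: open_odisk.
  by apply: (open_nbhs_nbhs (conj oG _)).
have H := bv zeta bz (1 - e); rewrite ifT in H; last exact/asboolP.
have := H ltac:(by rewrite ltrBlDr ltrDl); apply: filterS => w Hw Gw.
by apply: le_lt_trans (Hw Gw); rewrite lerD2r u1.
Unshelve. all: by end_near. Qed.

(** The last inequality on [s] and [h] says that the lower bound [(ln (h r) - ln (s r)) / (ln r - ln
    (s r))] of [harm_measure_ge_log] exceeds [1 - eps], so the annulus cannot miss the boundary. *)
Lemma delta_unif_perfect (O : set P) (h s : R -> R) (eps r0 r1 : R) :
  domain O -> 0 < eps < 1 -> 0 < r0 -> 0 < r1 ->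
  (forall a, bdry O a -> forall r, 0 < r < r0 ->
    forall z, O z -> cdist z a = h r -> w_ar O a r z <= 1 - eps) ->
  (forall r, 0 < r < r1 -> [/\ 0 < s r, s r < h r, h r < r &
     ln r - ln (h r) < eps * (ln r - ln (s r))]) ->
  exists2 r2, 0 < r2 & h_unif_perfect s r2 (bdry O).
Proof.
move=> [[p0 Op0] [oO cO]] eps01 r00 r10 dl hs.
have [d d0 dO] := nbhs_cdist (open_nbhs_nbhs (conj oO Op0)).
(* Of two points of [O] at distance [d / 2], one is at distance at least [d / 4] from [a]. With
   [r < d / 4], connectedness makes [O] meet the circle of radius [h r]. *)
pose p1 : P := (p0.1 + d / 2, p0.2).
have p01 : cdist p1 p0 = d / 2.
  rewrite /cdist /p1 /= subrr expr0n addr0 addrAC subrr add0r sqrtr_sqr ger0_norm//.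
  by rewrite ltW// divr_gt0.
have Op1 : O p1 by apply: dO; rewrite p01; lra.
exists (Num.min (Num.min r0 r1) (d / 4)).
  by rewrite !lt_min r00 r10 divr_gt0.
move=> a ba r /andP[rgt0]; rewrite !lt_min => /andP[/andP[rr0 rr1] rd].
have [s0 sh hr lns] := hs r ltac:(by rewrite rgt0 rr1).
apply: contrapT => nz.
have free zeta : bdry O zeta -> ~ (s r <= cdist zeta a <= r).
  by move=> bz H; apply: nz; exists zeta.
have [p Op hp] : exists2 p, O p & h r <= cdist p a.
  have [h0|h0] := leP (h r) (cdist p0 a); first by exists p0.
  exists p1 => //; have := cdist_triangle a p1 p0.
  by rewrite p01 [cdist a p0]cdistC; lra.
have h0 : 0 < h r by exact: lt_trans sh.
have [z Oz za] := @connected_meets_circle O a p (h r) cO ba.1 Op ltac:(by rewrite h0 hp).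
have := dl a ba r ltac:(by rewrite rgt0 rr0) z Oz za.
have := @harm_measure_ge_log O a z r (s r) oO ba
  ltac:(by rewrite s0 (lt_trans sh hr)) free Oz ltac:(by rewrite za).
move=> /le_trans H /H; rewrite za.
have lrs : 0 < ln r - ln (s r) by rewrite subr_gt0 ltr_ln// (lt_trans sh hr).
rewrite ler_pdivrMr// mulrBl mul1r; lra.
Qed.

Lemma closed_bdry (A : set P) : closed (bdry A).
Proof.
rewrite /bdry setDE; apply: closedI; first exact: closed_closure.
by apply: open_closedC; exact: open_interior.
Qed.

Lemma ln1V (r : R) : 0 < r -> ln (1 / r) = - ln r.
Proof. by move=> r0; rewrite div1r lnV. Qed.

Lemma ln_small (L : R) : exists2 r1 : R, 0 < r1 & forall r, 0 < r < r1 -> L < - ln r.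
Proof.
exists (expR (- L)); first exact: expR_gt0.
move=> r /andP[r0 rL]; rewrite ltrNr -[X in _ < X]expRK ltr_ln//.
by rewrite posrE expR_gt0.
Qed.

Lemma condDelta_h1_condU (O : set P) (alpha' : R) : domain O -> 1 < alpha' ->
  condDelta (h1 alpha') O -> exists alpha : R, 1 < alpha /\ condU (h1 alpha) (bdry O).
Proof.
move=> dO a1 [C [C0 [eps [r0 [eps01 [r00 dl]]]]]].
have e0 : 0 < eps by case/andP: eps01.
(* With [L = - ln r] and [|ln C| < (alpha' - 1) * L], the gap [ln r - ln (h r)] is below
   [2 * alpha' * L], which is [eps * (alpha - 1) * L]. *)
pose alpha := 1 + 2 * alpha' / eps.
have al : eps * (alpha - 1) = 2 * alpha'.
  by rewrite /alpha addrAC subrr add0r mulrC mulfVK// gt_eqF.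
have [r1 r10 Hr1] := ln_small (Num.max 1 (`|ln C| / (alpha' - 1))).
have [|r2 r20 H] := @delta_unif_perfect O (fun r => C * h1 alpha' r)
    (fun r => 1 * h1 alpha r) eps r0 r1 dO eps01 r00 r10 dl; last first.
- exists alpha; split; last first.
    by exists 1, r2; split=> //; split=> //; split=> //; exact: closed_bdry.
  by rewrite /alpha ltrDl divr_gt0// mulr_gt0//; lra.
move=> r /[dup] /andP[rgt0 rr1] /Hr1; rewrite gt_max => /andP[L1].
set L := - ln r in L1 *; rewrite ltr_pdivrMr ?subr_gt0// => LC.
have C1 := ler_norm (ln C).
have C2 : - ln C <= `|ln C| by rewrite -normrN ler_norm.
have lh : ln (C * h1 alpha' r) = ln C - alpha' * L.
  by rewrite lnM ?posrE ?powR_gt0// /h1 ln_powR /L; ring.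
have ls : ln (1 * h1 alpha r) = - (alpha * L).
  by rewrite mul1r /h1 ln_powR /L; ring.
have s0 : 0 < 1 * h1 alpha r by rewrite mul1r powR_gt0.
have h0 : 0 < C * h1 alpha' r by rewrite mulr_gt0 ?powR_gt0.
have eq2 : eps * (alpha - 1) * L = 2 * alpha' * L by rewrite al.
have lr : ln r = - L by rewrite /L opprK.
split => //.
- rewrite -ltr_ln// lh ls; have : 0 < alpha - 1 by rewrite -(pmulr_rgt0 _ e0) al; lra.
  nra.
- by rewrite -ltr_ln// lh lr; nra.
- by rewrite lh ls lr; nra.
Qed.

Lemma condDelta_h2_condU (O : set P) (beta' : R) : domain O -> 0 < beta' ->
  condDelta (h2 beta') O -> exists beta : R, 0 < beta /\ condU (h2 beta) (bdry O).
Proof.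
move=> dO b0 [C [C0 [eps [r0 [eps01 [r00 dl]]]]]].
have e0 : 0 < eps by case/andP: eps01.
(* With [M = ln (- ln r)] and [|ln C| < beta' * M], the gap [ln r - ln (h r) = beta' * M - ln C] is
   below [2 * beta' * M], hence below [eps * beta * M]. *)
pose beta := 3 * beta' / eps.
have be : eps * beta = 3 * beta'.
  by rewrite /beta mulrC mulfVK// gt_eqF.
have [r1 r10 Hr1] := ln_small (Num.max 1 (expR (`|ln C| / beta'))).
have [|r2 r20 H] := @delta_unif_perfect O (fun r => C * h2 beta' r)
    (fun r => 1 * h2 beta r) eps r0 r1 dO eps01 r00 r10 dl; last first.
- exists beta; split; last first.
    by exists 1, r2; split=> //; split=> //; split=> //; exact: closed_bdry.
  by rewrite /beta divr_gt0// mulr_gt0//; lra.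
move=> r /[dup] /andP[rgt0 rr1] /Hr1; rewrite gt_max => /andP[L1 LC].
set L := - ln r in L1 LC *; set M := ln L.
have L0 : 0 < L by lra.
have M0 : 0 < M by rewrite ln_gt0.
have {}LC : `|ln C| < beta' * M.
  by rewrite mulrC -ltr_pdivrMr// -[X in X < _]expRK ltr_ln// posrE expR_gt0.
have C1 := ler_norm (ln C).
have C2 : - ln C <= `|ln C| by rewrite -normrN ler_norm.
have lh b : ln (h2 b r) = - L - b * M.
  by rewrite /h2 lnM ?posrE ?powR_gt0 ?ln1V// ln_powR -/L -/M /L; ring.
have h0 b : 0 < h2 b r by rewrite /h2 mulr_gt0// powR_gt0// ln1V.
have lC : ln (C * h2 beta' r) = ln C + ln (h2 beta' r) by rewrite lnM ?posrE.
have eq2 : eps * beta * M = 3 * beta' * M by rewrite be.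
have lr : ln r = - L by rewrite /L opprK.
have hC : 0 < C * h2 beta' r by rewrite mulr_gt0.
have hb := h0 beta.
split => //.
- by rewrite mul1r.
- rewrite mul1r -ltr_ln// lC !lh.
  have : eps * (beta * M) < 1 * (beta * M).
    by rewrite ltr_pM2r ?(andP eps01).2// mulr_gt0// /beta divr_gt0// mulr_gt0.
  nra.
- by rewrite -ltr_ln// lC lh lr; nra.
- by rewrite mul1r lC !lh lr; nra.
Qed.

End DeltaToUniformlyPerfect.

(** * Potentials of Cantor measures supported in the boundary *)

Section CantorPotential.
Variable R : realType.
Notation P := (R * R)%type.
Notation mu := (@lebesgue_measure R).

Lemma ln_lipschitz (d x y : R) : 0 < d -> d <= x -> d <= y ->
  `|ln x - ln y| <= `|x - y| / d.
Proof.
move=> d0; wlog xy : x y / y <= x => [H|dx dy].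
  have [/H|/ltW/H H' dx dy] := leP y x; first exact.
  by rewrite distrC [`|x - y|]distrC; exact: H'.
have y0 : 0 < y by exact: lt_le_trans dy.
have x0 : 0 < x by exact: lt_le_trans dx.
rewrite !ger0_norm ?subr_ge0 ?ler_ln// -ln_div//.
have -> : x / y = 1 + (x - y) / y by field; rewrite gt_eqF.
have q0 : 0 <= (x - y) / y by rewrite divr_ge0 ?subr_ge0// ltW.
apply: (le_trans (le_ln1Dx _)); first by apply: lt_le_trans q0.
by rewrite ler_wpM2l ?subr_ge0// lef_pV2.
Qed.

Variables (K : set P) (g M : R -> R) (c : P -> R -> P) (rs : R).
Hypothesis Kcl : closed K.
(** The last inequality makes [M] reproduce itself: the average of [- ln (g r)], for the far half of
    the mass, and of [M (g r)], for the near half, is at most [M r]. *)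
Hypothesis gM : forall r, 0 < r < rs ->
  [/\ 0 < g r, 8 * g r <= r, 0 <= M r & - ln (g r) + M (g r) <= 2 * M r].
Hypothesis Kc : forall b r, K b -> 0 < r < rs ->
  [/\ K (c b r), 8 * g r <= cdist (c b r) b & cdist (c b r) b <= r].

(* Logarithmic potential of the uniform measure on the [2 ^ n] points reached
   from [b] by replacing [n] times each point by itself and its companion [c]. *)
Fixpoint pot n (b : P) (r : R) (z : P) : R :=
  if n is m.+1 then
    2^-1 * pot m b (g r) z + 2^-1 * pot m (c b r) (g r) z
  else - ln (cdist z b).

Let g_range r : 0 < r < rs -> 0 < g r < rs.
Proof. by move=> /[dup] /gM[g0 gr _ _] /andP[r0 r1]; lra. Qed.

Lemma pot_mean_value n b r : K b -> 0 < r < rs ->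
  mean_value_on (~` K) (pot n b r).
Proof.
elim: n b r => [|n IH] b r Kb rr /=.
  have nK : ~ (~` K) b by apply.
  have := mean_value_lin (- 1) 0 (mean_value_ln_cdist nK) (mean_value_cst (~` K) 0).
  by congr mean_value_on; apply/funext => z; ring.
have [Kc' _ _] := Kc Kb rr; have gr := g_range rr.
exact: (mean_value_lin 2^-1 2^-1 (IH _ _ Kb gr) (IH _ _ Kc' gr)).
Qed.

(** All the mass lies within [2 * r] of [b]: a companion is at distance at most [r], and
    [r + 2 * g r <= 2 * r] closes the induction. [pot_le] rests on the same fact. *)
Lemma pot_ge n b r z : K b -> 0 < r < rs -> ~ K z ->
  - ln (cdist z b + 2 * r) <= pot n b r z.
Proof.
move=> + + Kz; elim: n b r => [|n IH] b r Kb /[dup] rr /andP[r0 _] /=;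
  have zb : 0 < cdist z b by apply: cdist_gt0 => e; apply: Kz; rewrite e.
  by rewrite lerN2 ler_ln ?posrE; lra.
have [Kc' _ cb] := Kc Kb rr; have gr := g_range rr; have [g0 g8 _ _] := gM rr.
have := IH _ _ Kb gr; have := IH _ _ Kc' gr.
have zc := cdist_triangle b z (c b r); rewrite [cdist b _]cdistC in zc.
have zc0 := cdist_ge0 z (c b r).
have : ln (cdist z b + 2 * g r) <= ln (cdist z b + 2 * r).
  by rewrite ler_ln ?posrE; lra.
have : ln (cdist z (c b r) + 2 * g r) <= ln (cdist z b + 2 * r).
  by rewrite ler_ln ?posrE; lra.
lra.
Qed.

Lemma pot_le n b r z : K b -> 0 < r < rs -> 2 * r < cdist z b ->
  pot n b r z <= - ln (cdist z b - 2 * r).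
Proof.
elim: n b r => [|n IH] b r Kb /[dup] rr /andP[r0 _] /= zb.
  by rewrite lerN2 ler_ln ?posrE; lra.
have [Kc' _ cb] := Kc Kb rr; have gr := g_range rr; have [g0 g8 _ _] := gM rr.
have zc := cdist_triangle (c b r) z b.
have := IH _ _ Kb gr ltac:(lra); have := IH _ _ Kc' gr ltac:(lra).
have : ln (cdist z b - 2 * r) <= ln (cdist z b - 2 * g r).
  by rewrite ler_ln ?posrE; lra.
have : ln (cdist z b - 2 * r) <= ln (cdist z (c b r) - 2 * g r).
  by rewrite ler_ln ?posrE; lra.
lra.
Qed.

(** A quantitative form of [~ K z]: for fixed [d] the estimates below are uniform in [z]. *)
Definition away (d : R) (z : P) := 0 < d /\ forall b, K b -> d <= cdist z b.

Lemma pot_near_log n b r z d : K b -> 0 < r < rs -> away d z ->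
  `|pot n b r z + ln (cdist z b)| <= r / d.
Proof.
move=> + + [d0 dz]; elim: n b r => [|n IH] b r Kb /[dup] rr /andP[r0 _] /=.
  by rewrite addNr normr0 divr_ge0// ltW.
have [Kc' _ cb] := Kc Kb rr; have gr := g_range rr; have [g0 g8 _ _] := gM rr.
have := IH _ _ Kb gr; have := IH _ _ Kc' gr.
have : `|ln (cdist z b) - ln (cdist z (c b r))| <= r / d.
  apply: (le_trans (ln_lipschitz d0 (dz _ Kb) (dz _ Kc'))).
  rewrite ler_pM2r ?invr_gt0//; apply: le_trans cb.
  have := cdist_triangle b z (c b r); have := cdist_triangle (c b r) z b.
  by rewrite [cdist b _]cdistC ler_norml => *; lra.
have : 8 * (g r / d) <= r / d by rewrite mulrA ler_pM2r ?invr_gt0.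
set x := r / d; set y := g r / d.
rewrite !ler_norml => h8 /andP[h1 h2] /andP[h3 h4] /andP[h5 h6].
by apply/andP; split; lra.
Qed.

(** Removing the first level expresses the difference as an average of two differences at scale
    [g r <= r / 8], which more than pays for the factor [2 ^- 1]. For [n = 0] this is
    [pot_near_log]. *)
Lemma pot_cauchy n m b r z d : K b -> 0 < r < rs -> away d z ->
  `|pot (n + m) b r z - pot n b r z| <= r / d / 2 ^+ n.
Proof.
move=> + + sd; elim: n b r => [|n IH] b r Kb /[dup] rr /andP[r0 _].
  by rewrite add0n /= opprK expr0 divr1; exact: pot_near_log.
have [Kc' _ cb] := Kc Kb rr; have gr := g_range rr; have [g0 g8 _ _] := gM rr.
have := IH _ _ Kb gr; have := IH _ _ Kc' gr; rewrite addSn /=.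
have : 8 * (g r / d / 2 ^+ n) <= 2 * (r / d / 2 ^+ n.+1).
  rewrite exprS invfM !mulrA ler_pM2r ?invr_gt0 ?exprn_gt0//.
  rewrite [2 * r / d / 2]mulrC !mulrA mulVf// mul1r ler_pM2r ?invr_gt0//.
  by case: sd.
set x := r / d / _; set y := g r / d / _.
rewrite !ler_norml => h8 /andP[h1 h2] /andP[h3 h4].
by apply/andP; split; lra.
Qed.

Lemma pot_lipschitz n b r z w d : K b -> 0 < r < rs ->
  away d z -> away d w ->
  `|pot n b r z - pot n b r w| <= cdist z w / d.
Proof.
move=> + + [d0 dz] [_ dw]; elim: n b r => [|n IH] b r Kb rr /=.
  rewrite opprK addrC (le_trans (ln_lipschitz d0 (dw _ Kb) (dz _ Kb)))//.
  rewrite ler_pM2r ?invr_gt0//.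
  have := cdist_triangle z w b; have := cdist_triangle w z b.
  by rewrite [cdist w z]cdistC ler_norml => *; lra.
have [Kc' _ cb] := Kc Kb rr; have gr := g_range rr.
have := IH _ _ Kb gr; have := IH _ _ Kc' gr.
rewrite !ler_norml => /andP[h1 h2] /andP[h3 h4].
by apply/andP; split; lra.
Qed.

(* A point [z] is far from [b] or from its companion, so at each level half of
   the remaining mass contributes at most [- ln (g r)]. *)
Lemma pot_bound n b r z d : K b -> 0 < r < rs -> away d z ->
  pot n b r z <= M r + `|ln d| / 2 ^+ n.
Proof.
move=> + + [d0 dz]; elim: n b r => [|n IH] b r Kb /[dup] rr /andP[r0 _] /=;
  have [g0 g8 M0 MM] := gM rr.
  (* A single point mass is controlled only by [|ln d|]; this term is halved at each level and
     disappears in the limit. *)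
  rewrite expr0 divr1; have : ln d <= ln (cdist z b).
    by have := dz _ Kb => H; rewrite ler_ln ?posrE//; lra.
  have : - ln d <= `|ln d| by rewrite -normrN ler_norm.
  lra.
have [Kc' cb8 cb] := Kc Kb rr; have gr := g_range rr.
have IH1 := IH _ _ Kb gr; have IH2 := IH _ _ Kc' gr.
have -> : `|ln d| / 2 ^+ n.+1 = 2^-1 * (`|ln d| / 2 ^+ n).
  by rewrite exprS invfM; ring.
have tr := cdist_triangle z (c b r) b; rewrite [cdist (c b r) z]cdistC in tr.
(* Since [b] and its companion are [8 * g r] apart, [z] is at distance at least [4 * g r] from one
   of them, whose mass lies within [2 * g r]. *)
have far x : K x -> 4 * g r <= cdist z x -> pot n x (g r) z <= - ln (g r).
  move=> Kx zx; apply: (le_trans (pot_le _ Kx gr _)); first by lra.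
  by rewrite lerN2 ler_ln ?posrE; lra.
have [zb|zb] := leP (4 * g r) (cdist z b).
  have := far _ Kb zb; lra.
have := far _ Kc' ltac:(lra); lra.
Qed.

Lemma awayW d e z : 0 < e <= d -> away d z -> away e z.
Proof.
move=> /andP[e0 ed] [_ dz]; split => // b Kb; exact: le_trans (dz _ Kb).
Qed.

Lemma nbhs_away z : ~ K z ->
  exists2 d, 0 < d & \forall w \near z, away d w.
Proof.
move=> Kz; have /nbhs_cdist[e e0 eK] : nbhs z (~` K).
  by apply: open_nbhs_nbhs; split => //; exact: closed_openC.
have e20 : 0 < e / 2 by rewrite divr_gt0.
exists (e / 2) => //; apply: filterS (near_cdist z e20) => w wz.
split => // b Kb; have : e <= cdist b z.
  by rewrite leNgt; apply/negP => /eK; exact.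
by have := cdist_triangle w b z; rewrite [cdist b w]cdistC; lra.
Qed.

Lemma disk_away z rho : (forall w, cdist w z <= rho -> ~ K w) ->
  exists d, forall w, cdist w z <= rho -> away d w.
Proof.
move=> dK.
have cpt := (compact_near_coveringP _).1 (@compact_closed_disk R z rho).
have cov w : cdist w z <= rho ->
    \forall w' \near w & d \near (0 : R)^'+, away d w'.
  move=> /dK/nbhs_away[d d0 dw].
  exists ([set x | away d x], [set e | 0 < e <= d]).
    split => //=; near=> e; apply/andP; split; near: e.
      exact: nbhs_right_gt.
    exact: nbhs_right_le.
  by move=> [w' e] [/= dw' ed]; exact: awayW dw'.
have H := cpt R (0 : R)^'+ (fun d w => away d w) _ cov.
exact: (@filter_ex R (0 : R)^'+ (at_right_proper_filter 0) _ (H _)).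
Unshelve. all: by end_near. Qed.

(** The limit is the supremum of the lower bounds [pot n b r z - r / d / 2 ^+ n]. It is formed with
    one admissible [d0], and [sup_le] shows that another [d] gives the same value. Where no [d] is
    admissible, the value 0 is arbitrary. *)
Lemma pot_limit b r : K b -> 0 < r < rs ->
  exists p : P -> R, forall z d n, away d z ->
    `|p z - pot n b r z| <= r / d / 2 ^+ n.
Proof.
move=> Kb rr; have r0 : 0 < r by case/andP: rr.
suff /choice[p Hp] : forall z, exists l, forall d n, away d z ->
    `|l - pot n b r z| <= r / d / 2 ^+ n by exists p.
move=> z.
have [[d0 sd0]|ns] := pselect (exists d, away d z); last first.
  by exists 0 => d n sd; case: ns; exists d.
pose X d := [set pot n b r z - r / d / 2 ^+ n | n in [set: nat]].
have E_ge0 d n : away d z -> 0 <= r / d / 2 ^+ n.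
  by move=> [d_gt0 _]; rewrite !divr_ge0 ?exprn_ge0// ltW.
have XU d d' n m : away d z -> away d' z ->
    pot n b r z - r / d / 2 ^+ n <= pot m b r z + r / d' / 2 ^+ m.
  move=> sd sd'; have e1 := E_ge0 d n sd; have e2 := E_ge0 d' m sd'.
  have [nm|/ltnW mn] := leqP n m.
    have := pot_cauchy n (m - n) Kb rr sd; rewrite subnKC// ler_norml.
    by move=> /andP[h1 h2]; lra.
  have := pot_cauchy m (n - m) Kb rr sd'; rewrite subnKC// ler_norml.
  by move=> /andP[h1 h2]; lra.
have supX d n : away d z -> pot n b r z - r / d / 2 ^+ n <= sup (X d).
  move=> sd; apply: ub_le_sup; last by exists n.
  by exists (pot 0 b r z + r / d / 2 ^+ 0) => _ [m _ <-]; exact: XU.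
have Xsup d d' m : away d z -> away d' z ->
    sup (X d) <= pot m b r z + r / d' / 2 ^+ m.
  move=> sd sd'; apply: ge_sup; first by exists (pot 0 b r z - r / d / 2 ^+ 0), 0.
  by move=> _ [n _ <-]; exact: XU.
have sup_le d d' : away d z -> away d' z -> sup (X d) <= sup (X d').
  move=> sd sd'; rewrite -subr_le0.
  apply: (@le_geometric_le0 _ _ (r / d + r / d + r / d' + r / d')) => n.
  have := Xsup d d' n sd sd'; have := supX d' n sd'.
  have := E_ge0 d n sd; rewrite !mulrDl; lra.
exists (sup (X d0)) => d n sd; rewrite ler_norml.
have := supX d n sd; have := sup_le d d0 sd sd0; have := Xsup d0 d n sd0 sd.
by move=> h1 h2 h3; apply/andP; split; lra.
Qed.

(** A closed disk off [K] is compact, so one [d] serves all of it and convergence is uniform there;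
    continuity comes from [pot_lipschitz], which is uniform in [n]. *)
Lemma pot_limit_mean_value b r p : K b -> 0 < r < rs ->
  (forall z d n, away d z -> `|p z - pot n b r z| <= r / d / 2 ^+ n) ->
  mean_value_on (~` K) p.
Proof.
move=> Kb rr Hp.
have lip z w d : away d z -> away d w -> `|p z - p w| <= cdist z w / d.
  move=> sz sw; rewrite -subr_le0; apply: (@le_geometric_le0 _ _ (r / d + r / d)) => n.
  have := Hp z d n sz; have := Hp w d n sw; have := pot_lipschitz n Kb rr sz sw.
  rewrite lerBlDr [in X in _ -> _ -> _ -> _ <= X]mulrDl !ler_norml.
  by move=> /andP[h1 h2] /andP[h3 h4] /andP[h5 h6]; apply/andP; split; lra.
have cp z : (~` K) z -> {for z, continuous p}.
  move=> Kz; have [d d0 dz] := nbhs_away Kz.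
  apply/cvgrPdist_lt => e e0.
  have ed : 0 < e * d by rewrite mulr_gt0.
  have H := near_cdist z ed; near=> w.
  apply: (@le_lt_trans _ _ (cdist z w / d)).
    by apply: lip; [exact: nbhs_singleton dz|near: w].
  by rewrite ltr_pdivrMr// cdistC; near: w.
split => // z rho rho0 dK.
have [d sd] := disk_away dK.
have zz : cdist z z <= rho by rewrite cdistxx ltW.
(* Shifted by plus or minus the error [r / d / 2 ^+ n], the potential of level [n] encloses [p] on
   the circle and keeps its mean value property. *)
have ct n s : mean_value_on (~` K) (fun w => 1 * pot n b r w + s * 1).
  by apply: mean_value_lin; [exact: pot_mean_value|exact: mean_value_cst].
have cpt := continuous_on_circle rho0 cp dK.
have pi0 := pi_gt0 R.
have bndt n t : `|p (circ_pt z rho t) - pot n b r (circ_pt z rho t)| <= r / d / 2 ^+ n.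
  by apply/Hp/sd; rewrite cdist_circ_pt// ltW.
apply/eqP; rewrite eq_le -subr_le0 -[_ <= \int[_]_(_ in _) _]subr_le0.
apply/andP; split; apply: (@le_geometric_le0 _ _ (4 * pi * (r / d))) => n.
- have [cn mn] := ct n (r / d / 2 ^+ n).
  have : (\int[mu]_(t in `[0, 2 * pi]) p (circ_pt z rho t) <=
    \int[mu]_(t in `[0, 2 * pi]) (1 * pot n b r (circ_pt z rho t) + r / d / 2 ^+ n * 1))%R.
    apply: le_Rintegral_circle => //; first exact: (continuous_on_circle rho0 cn dK).
    by move=> t; have := bndt n t; rewrite ler_norml => /andP[h1 h2]; lra.
  rewrite mn// mul1r mulr1; have := Hp z d n (sd _ zz); rewrite ler_norml.
  rewrite -[4 * pi * _ / _]mulrA; set E := r / d / _ => /andP[h1 h2] h3.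
  have : pi * (pot n b r z - p z) <= pi * E by rewrite ler_pM2l//; lra.
  lra.
- have [cn mn] := ct n (- (r / d / 2 ^+ n)).
  have : (\int[mu]_(t in `[0, 2 * pi]) (1 * pot n b r (circ_pt z rho t) + - (r / d / 2 ^+ n) * 1) <=
     \int[mu]_(t in `[0, 2 * pi]) p (circ_pt z rho t))%R.
    apply: le_Rintegral_circle => //; first exact: (continuous_on_circle rho0 cn dK).
    by move=> t; have := bndt n t; rewrite ler_norml => /andP[h1 h2]; lra.
  rewrite mn// mul1r mulr1; have := Hp z d n (sd _ zz); rewrite ler_norml.
  rewrite -[4 * pi * _ / _]mulrA; set E := r / d / _ => /andP[h1 h2] h3.
  have : pi * (p z - pot n b r z) <= pi * E by rewrite ler_pM2l//; lra.
  lra.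
Unshelve. all: by end_near. Qed.

Lemma pot_limit_bounds b r p : K b -> 0 < r < rs ->
  (forall z d n, away d z -> `|p z - pot n b r z| <= r / d / 2 ^+ n) ->
  forall z, ~ K z -> [/\ p z <= M r, - ln (cdist z b + 2 * r) <= p z &
    2 * r < cdist z b -> p z <= - ln (cdist z b - 2 * r)].
Proof.
move=> Kb rr Hp z Kz; have [d _ /nbhs_singleton sd] := nbhs_away Kz.
split=> [||rz]; rewrite -subr_le0.
- apply: (@le_geometric_le0 _ _ (r / d + `|ln d|)) => n.
  have := Hp z d n sd; have := pot_bound n Kb rr sd.
  by rewrite mulrDl ler_norml => h1 /andP[h2 h3]; lra.
- apply: (@le_geometric_le0 _ _ (r / d)) => n.
  have := Hp z d n sd; have := pot_ge n Kb rr Kz.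
  by rewrite ler_norml => h1 /andP[h2 h3]; lra.
- apply: (@le_geometric_le0 _ _ (r / d)) => n.
  have := Hp z d n sd; have := pot_le n Kb rr rz.
  by rewrite ler_norml => h1 /andP[h2 h3]; lra.
Qed.

End CantorPotential.

Lemma cantor_potential (R : realType) (K : set (R * R)) (g M : R -> R) (rs : R) :
  closed K ->
  (forall r, 0 < r < rs ->
    [/\ 0 < g r, 8 * g r <= r, 0 <= M r & - ln (g r) + M (g r) <= 2 * M r]) ->
  (forall b r, K b -> 0 < r < rs ->
    exists b', K b' /\ 8 * g r <= cdist b' b <= r) ->
  forall b r, K b -> 0 < r < rs -> exists p : R * R -> R,
    mean_value_on (~` K) p /\
    forall z, ~ K z -> [/\ p z <= M r, - ln (cdist z b + 2 * r) <= p z &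
      2 * r < cdist z b -> p z <= - ln (cdist z b - 2 * r)].
Proof.
move=> Kcl gM Kp b r Kb rr.
have [c Hc] : exists c : (R * R) * R -> R * R, forall br, K br.1 -> 0 < br.2 < rs ->
    [/\ K (c br), 8 * g br.2 <= cdist (c br) br.1 & cdist (c br) br.1 <= br.2].
  suff /choice[c Hc] : forall br : (R * R) * R, exists b', K br.1 -> 0 < br.2 < rs ->
    [/\ K b', 8 * g br.2 <= cdist b' br.1 & cdist b' br.1 <= br.2] by exists c.
  move=> [b0 s] /=; have [[Kb0 ss]|ns] := pselect (K b0 /\ 0 < s < rs); last first.
    by exists b0 => ? ?; case: ns.
  by have [b' [Kb' /andP[? ?]]] := Kp b0 s Kb0 ss; exists b'.
pose c' b s := c (b, s).
have Kc b0 s : K b0 -> 0 < s < rs ->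
  [/\ K (c' b0 s), 8 * g s <= cdist (c' b0 s) b0 & cdist (c' b0 s) b0 <= s].
  exact: (Hc (b0, s)).
have [p Hp] := pot_limit gM Kc Kb rr.
exists p; split; first exact: (pot_limit_mean_value Kcl gM Kc Kb rr Hp).
exact: (pot_limit_bounds Kcl gM Kc Kb rr Hp).
Qed.

(** * From uniform perfectness to harmonic measure bounds *)

Section UniformlyPerfectToDelta.
Variable R : realType.
Notation P := (R * R)%type.

(* Normalising the potential to the value 0 on the outer circle and bounding it
   by [m] gives the competitor [1 - (p + ln (rad / 2)) / (m + ln (rad / 2))]. *)
Lemma w_ar_le (O : set P) (a z : P) (p : P -> R) (rad rho m eps : R) :
  open O -> mean_value_on (~` bdry O) p ->
  (forall w, ~ bdry O w -> [/\ p w <= m, - ln (cdist w a + 2 * rho) <= p w &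
      2 * rho < cdist w a -> p w <= - ln (cdist w a - 2 * rho)]) ->
  0 < rho -> 8 * rho <= rad -> O z -> cdist z a = rho -> 0 < eps < 1 ->
  eps * (m + ln (rad / 2)) <= ln (rad / 2) - ln (3 * rho) ->
  w_ar O a rad z <= 1 - eps.
Proof.
move=> oO [cp mp] pb rho0 rhor Oz za eps01 Heps.
have offK w : O w -> ~ bdry O w.
  by move=> Ow [_]; apply; exact: (open_nbhs_nbhs (conj oO Ow)).
rewrite /w_ar; set G := O `&` odisk a rad; set E := O `&` circle a rad.
have Gz : G z by split => //; rewrite /odisk /= za; lra.
rewrite ifT; last exact/asboolP.
have lt3 : ln (3 * rho) < ln (rad / 2) by rewrite ltr_ln ?posrE; lra.
have pz : - ln (3 * rho) <= p z.
  have [_ + _] := pb _ (offK _ Oz); rewrite za.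
  by have -> : rho + 2 * rho = 3 * rho by ring.
have pm : p z <= m by have [] := pb _ (offK _ Oz).
(* Positivity of [D] is read off at [z]: [m >= p z >= - ln (3 * rho) > - ln (rad / 2)]. *)
pose D := m + ln (rad / 2); have D0 : 0 < D by rewrite /D; lra.
pose v w := 1 - (p w + ln (rad / 2)) / D.
have v0 w : G w -> 0 <= v w.
  move=> [Ow _]; rewrite /v subr_ge0 ler_pdivrMr// mul1r lerD2r.
  by have [] := pb _ (offK _ Ow).
have vin : upper_perron G (fun zeta => if `[< E zeta >] then 1 else 0) v.
  split.
  - apply: mean_value_superharmonic.
    suff : mean_value_on (~` bdry O) v.
      move=> [cv mv]; split => [w [Ow _]|w s s0 sG].
        by apply: cv; exact: offK.
      by apply: mv => // x /sG[Ox _]; exact: offK.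
    have := mean_value_lin (- D^-1) (1 - ln (rad / 2) / D) (conj cp mp)
      (mean_value_cst (~` bdry O) 1).
    by congr mean_value_on; apply/funext => w; rewrite /v; ring.
  - by exists 0.
  - move=> zeta _ c; case: asboolP => [[_ zr] c1|_ c0]; last first.
      by apply: (@filterE _ (nbhs zeta)) => w Gw; exact: lt_le_trans (v0 w Gw).
    (* Here [|w - a| - 2 * rho > rad - 3 * rho >= rad / 2], so [p w <= - ln (rad / 2)] and
       [v w >= 1]. *)
    have H : \forall w \near zeta, rad - rho < cdist w a.
      apply: (cvgr_gt _ (@continuous_cdist R a zeta)).
      by move: zr; rewrite /circle /= => ->; lra.
    apply: filterS H => w wr [Ow _]; apply: (lt_le_trans c1).
    rewrite /v lerBrDr gerDl pmulr_lle0 ?invr_gt0//.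
    have [_ _ /(_ _)] := pb _ (offK _ Ow); move=> /(_ ltac:(lra)).
    have : ln (rad / 2) <= ln (cdist w a - 2 * rho) by rewrite ler_ln ?posrE; lra.
    lra.
have vz : v z <= 1 - eps.
  rewrite lerD2l lerN2 ler_pdivlMr//; apply: (le_trans Heps); lra.
apply: le_trans vz; apply: ge_inf; last by exists v.
(* [ge_inf] needs a lower bound for all competitors at [z]; the minimum principle against 0 gives
   one. *)
exists 0 => _ [u [shu [mm mu_] bu] <-].
apply: (@minimum_principle _ G a rad u (fun=> 0)) => //.
- by apply: openI => //; exact: open_odisk.
- by move=> w [].
- exact: mean_value_cst.
- by exists mm => w Gw; rewrite subr0; exact: mu_.
move=> zeta bz e e0; apply: bu => //; rewrite sub0r.
by case: ifP => _; lra.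
Qed.

(** The Cantor set is built around [a] at scale [h r]. The condition on [eps] asks that the rise of
    the potential from the outer circle to the circle of radius [h r] be a fixed fraction of its
    total range. *)
Lemma unif_perfect_delta (O : set P) (H g M h : R -> R) (rs eps : R) :
  domain O -> 0 < rs -> 0 < eps < 1 ->
  h_unif_perfect H rs (bdry O) ->
  (forall r, 0 < r < rs -> [/\ 0 < g r, 8 * g r <= r, 8 * g r <= H r, 0 <= M r &
    - ln (g r) + M (g r) <= 2 * M r]) ->
  (forall r, 0 < r < rs -> [/\ 0 < h r, 8 * h r <= r &
    eps * (M (h r) + ln (r / 2)) <= ln (r / 2) - ln (3 * h r)]) ->
  condDelta_h h O.
Proof.
move=> [_ [oO _]] rs0 eps01 Hp gM hM; exists eps, rs; do 2!split => //.
move=> a ba r rr z Oz za; have [h0 h8 he] := hM r rr.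
have rr' : 0 < h r < rs by rewrite h0; case/andP: rr => *; lra.
have [||p [mp pb]] := @cantor_potential R (bdry O) g M rs
  (@closed_bdry R O) _ _ a (h r) ba rr'.
- by move=> s /gM[].
- move=> b s Kb ss; have [b' [Kb' /andP[b1 b2]]] := Hp b Kb s ss.
  exists b'; split => //; rewrite b2 andbT.
  by have [_ _ + _ _] := gM s ss; move=> /le_trans; apply.
exact: (w_ar_le oO mp pb h0 h8 Oz za eps01 he).
Qed.

Lemma h_unif_perfectW (H : R -> R) (r0 r1 : R) (K : set P) : r1 <= r0 ->
  h_unif_perfect H r0 K -> h_unif_perfect H r1 K.
Proof.
by move=> r10 HK a Ka r /andP[r_gt0 rr1]; apply: HK => //; rewrite r_gt0; lra.
Qed.

Lemma condU_h1_condDelta (O : set P) (alpha : R) : domain O -> 1 < alpha < 2 ->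
  condU (h1 alpha) (bdry O) ->
  exists alpha' : R, 1 < alpha' /\ condDelta (h1 alpha') O.
Proof.
move=> dO /andP[a1 a2] [C [r0 [C0 [r00 [_ HK]]]]].
(* An exponent above [alpha] absorbs the constants 8 and [C] for small [r]. Then [A] solves
   [al * (1 + A) = 2 * A], which is the inequality on [M r = A * - ln r] with equality; [al < 2]
   makes it positive. *)
pose al := 1 + alpha / 2; have al1 : alpha < al < 2 by rewrite /al; lra.
pose A := al / (2 - al); have A1 : 1 < A by rewrite /A ltr_pdivlMr; lra.
have alA : al * (1 + A) = 2 * A by rewrite /A; field; lra.
have ln2 : 0 < ln (2 : R) by rewrite ln_gt0//; lra.
have ln3 : 0 < ln (3 : R) by rewrite ln_gt0//; lra.
have ln8 : ln (8 : R) = 3 * ln 2.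
  by rewrite (_ : 8 = 2 ^+ 3) ?lnXn// ?mulr_natl//; ring.
have [r1 r10 Hr1] := ln_small (Num.max (Num.max (`|ln 8 - ln C| / (al - alpha))
   (ln 8 / (al - 1))) (ln 8 + 2 * (ln 2 + ln 3))).
have Ls r : 0 < r < r1 -> [/\ ln 8 - ln C < (al - alpha) * - ln r,
    ln 8 < (al - 1) * - ln r & ln 8 + 2 * (ln 2 + ln 3) < - ln r].
  move=> /Hr1; rewrite !gt_max ltr_pdivrMr; last by lra.
  rewrite ltr_pdivrMr; last by lra.
  move=> /andP[/andP[h1 h2] h3]; split => //; rewrite mulrC//.
  by apply: le_lt_trans h1; exact: ler_norm.
exists 2; split; first by lra.
exists 1; split => //.
(* For [h r = r ^ 2] and [L = - ln r], [M (h r) = 2 * A * L], so this [eps] makes the left side at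
   most [L / 2]; the right side is [L - ln 2 - ln 3]. *)
have eps01 : 0 < (4 * A)^-1 < 1.
  have A4 : 0 < 4 * A by lra.
  by rewrite invr_gt0 A4 invf_lt1//; lra.
apply: (@unif_perfect_delta O (fun r => C * h1 alpha r) (fun r => r `^ al)
  (fun r => A * - ln r) _ (Num.min r0 r1) _ dO _ eps01).
- by rewrite lt_min r00.
- by apply: h_unif_perfectW HK; rewrite ge_min lexx.
- move=> r /andP[r_gt0]; rewrite lt_min => /andP[rr0 rr1].
  have [L1 L2 L3] := Ls r ltac:(by rewrite r_gt0).
  have g0 := powR_gt0 al r_gt0; have h0 := powR_gt0 alpha r_gt0.
  have L0 : 0 < - ln r by clear -L3 ln8 ln2 ln3; lra.
  split => //.
  + rewrite -ler_ln ?posrE ?mulr_gt0// lnM ?posrE// ln_powR.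
    by clear -L2; lra.
  + rewrite -ler_ln ?posrE ?mulr_gt0// !lnM ?posrE// /h1 !ln_powR.
    by clear -L1; lra.
  + by rewrite mulr_ge0// ltW// (lt_trans _ A1).
  + rewrite ln_powR.
    have -> : - (al * ln r) + A * - (al * ln r) = al * (1 + A) * - ln r by ring.
    by rewrite alA mulrA.
- move=> r /andP[r_gt0]; rewrite lt_min => /andP[rr0 rr1].
  have [L1 L2 L3] := Ls r ltac:(by rewrite r_gt0).
  have h0 := powR_gt0 2 r_gt0; rewrite /h1 !mul1r; split => //.
  + rewrite -ler_ln ?posrE ?mulr_gt0// lnM ?posrE// ln_powR.
    by clear -L3 ln8 ln2 ln3; lra.
  + rewrite lnM ?posrE// ln_div ?posrE// ln_powR.
    have -> : (4 * A)^-1 * (A * - (2 * ln r) + (ln r - ln 2)) =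
      - ln r / 2 - (4 * A)^-1 * (- ln r + ln 2) by field; rewrite gt_eqF// (lt_trans _ A1).
    have : 0 <= (4 * A)^-1 * (- ln r + ln 2).
      rewrite mulr_ge0// ?ltW ?(andP eps01).1//.
      by clear -L3 ln8 ln2 ln3; lra.
    by clear -L3 ln8 ln2 ln3; lra.
Qed.

Lemma condU_h2_condDelta (O : set P) (beta : R) : domain O -> 0 < beta ->
  condU (h2 beta) (bdry O) ->
  exists beta' : R, 0 < beta' /\ condDelta (h2 beta') O.
Proof.
move=> dO b0 [C [r0 [C0 [r00 [_ HK]]]]].
(* The additional factor [(- ln r)^-1] in [h2 be] absorbs 8 and [C]. *)
pose be := beta + 1; have be1 : 1 < be by rewrite /be; lra.
have be0 : 0 < be by rewrite (lt_trans _ be1).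
have ln2 : 0 < ln (2 : R) by rewrite ln_gt0//; lra.
have ln3 : 0 < ln (3 : R) by rewrite ln_gt0//; lra.
have ln8 : ln (8 : R) = 3 * ln 2.
  by rewrite (_ : 8 = 2 ^+ 3) ?lnXn// ?mulr_natl//; ring.
have [r1 r10 Hr1] := ln_small (Num.max (Num.max 1 (2 * be))
   (expR (ln 8 + `|ln C| + 2 * (ln 2 + ln 3)))).
have Ls r : 0 < r < r1 -> [/\ 1 < - ln r, 2 * be < - ln r &
    ln 8 + `|ln C| + 2 * (ln 2 + ln 3) < ln (- ln r)].
  move=> /Hr1; rewrite !gt_max => /andP[/andP[h1 h2] h3]; split => //.
  by rewrite -[X in X < _]expRK ltr_ln ?posrE ?expR_gt0//; lra.
have C1 := ler_norm (ln C).
have C2 : - ln C <= `|ln C| by rewrite -normrN ler_norm.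
have C3 := normr_ge0 (ln C).
(* Concavity of the logarithm: [ln (1 + x) <= x] with [x = k * ln L / L]. *)
have lnD (L k : R) : 1 < L -> 0 <= k -> ln (L + k * ln L) <= (1 + k / L) * ln L.
  move=> L1 k0; have l0 : 0 < ln L by rewrite ln_gt0.
  have L0 : 0 < L by lra.
  have -> : L + k * ln L = L * (1 + k * ln L / L) by field; rewrite gt_eqF.
  have q0 : 0 <= k * ln L / L by rewrite divr_ge0 ?mulr_ge0// ltW.
  rewrite lnM ?posrE//; last by lra.
  have := @le_ln1Dx R (k * ln L / L) ltac:(lra).
  have -> : (1 + k / L) * ln L = ln L + k * ln L / L by ring.
  lra.
have lnh (b r : R) : 0 < r -> 1 < - ln r -> ln (h2 b r) = ln r - b * ln (- ln r).
  move=> r_gt0 L1; rewrite /h2 lnM ?posrE ?powR_gt0 ?ln1V//; last by lra.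
  by rewrite ln_powR; ring.
have h_gt0 (b r : R) : 0 < r -> 1 < - ln r -> 0 < h2 b r.
  by move=> r_gt0 L1; rewrite /h2 mulr_gt0// powR_gt0// ln1V//; lra.
have kh_gt0 (k b r : R) : 0 < k -> 0 < r -> 1 < - ln r -> 0 < k * h2 b r.
  by move=> k0 r_gt0 L1; apply: mulr_gt0 => //; exact: h_gt0.
have lnkh (k b r : R) : 0 < k -> 0 < r -> 1 < - ln r ->
    ln (k * h2 b r) = ln k + (ln r - b * ln (- ln r)).
  move=> k0 r_gt0 L1; rewrite -lnh//; apply: lnM; rewrite posrE//.
  exact: h_gt0.
exists 1; split => //; exists 1; split => //.
(* For [h r = r / (- ln r)], the terms [- ln r] cancel in [M (h r) + ln (r / 2)], leaving at most
   [(1 + 8 * be) * l] with [l = ln (- ln r)]. Dividing by [B] gives [l / 2], while the right side is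
   [l - ln 2 - ln 3]. *)
pose B := 2 * (1 + 8 * be).
have B1 : 1 < B by rewrite /B; lra.
have eps01 : 0 < B^-1 < 1 by rewrite invr_gt0 invf_lt1; lra.
apply: (@unif_perfect_delta O (fun r => C * h2 beta r) (h2 be)
  (fun r => - ln r + 4 * be * ln (- ln r)) _ (Num.min r0 r1) _ dO _ eps01).
- by rewrite lt_min r00.
- by apply: h_unif_perfectW HK; rewrite ge_min lexx.
- move=> r /andP[r_gt0]; rewrite lt_min => /andP[rr0 rr1].
  have [L1 L2 L3] := Ls r ltac:(by rewrite r_gt0).
  have l0 : 0 < ln (- ln r) by rewrite ln_gt0.
  have g0 := h_gt0 be r r_gt0 L1; have h0 := h_gt0 beta r r_gt0 L1.
  have bl : ln (- ln r) <= be * ln (- ln r) by rewrite ler_peMl// ltW.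
  split => //.
  + rewrite -ler_ln ?posrE ?kh_gt0// lnkh//.
    by clear -bl L3 C3 ln2 ln3; lra.
  + rewrite -ler_ln ?posrE ?kh_gt0// !lnkh//.
    have -> : be * ln (- ln r) = beta * ln (- ln r) + ln (- ln r) by rewrite /be; ring.
    by clear -L3 C2 ln2 ln3; lra.
  + by clear -bl l0 L1; lra.
  + rewrite lnh//; have := lnD (- ln r) be L1 (ltW be0).
    have -> : - (ln r - be * ln (- ln r)) = - ln r + be * ln (- ln r) by ring.
    set l := ln (- ln r) in L3 l0 bl *; set L1' := ln (_ + be * l) => h.
    (* The factor [3 / 2] is exactly what fits: [2 * be * l + 4 * be * (3 / 2 * l) = 8 * be * l],
       which is why [M] carries the coefficient [4 * be]. *)
    have h' : L1' <= 3 / 2 * l.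
      apply: (le_trans h); rewrite ler_wpM2r ?(ltW l0)//.
      have : be / - ln r <= 2^-1.
        by rewrite ler_pdivrMr ?(lt_trans _ L1)//; clear -L2; lra.
      by clear; lra.
    have : 4 * be * L1' <= 4 * be * (3 / 2 * l) by rewrite ler_pM2l// mulr_gt0.
    by clear; lra.
- move=> r /andP[r_gt0]; rewrite lt_min => /andP[rr0 rr1].
  have [L1 L2 L3] := Ls r ltac:(by rewrite r_gt0).
  have l0 : 0 < ln (- ln r) by rewrite ln_gt0.
  have h0 := h_gt0 1 r r_gt0 L1; rewrite !mul1r; split => //.
  + rewrite -ler_ln ?posrE ?kh_gt0// lnkh//.
    by clear -L3 C3 ln2 ln3; lra.
  + rewrite lnkh// ln_div ?posrE// lnh//.
    have := lnD (- ln r) 1 L1 ler01.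
    rewrite mul1r.
    have -> : - (ln r - ln (- ln r)) = - ln r + ln (- ln r) by ring.
    set l := ln (- ln r) in L3 l0 *; set l1 := ln (_ + l) => h.
    have h' : l1 <= 2 * l.
      apply: (le_trans h); rewrite ler_wpM2r ?(ltW l0)//.
      have : 1 / - ln r <= 1.
        by rewrite ler_pdivrMr ?(lt_trans _ L1)// mul1r ltW.
      by clear; lra.
    have h2' : 4 * be * l1 <= 4 * be * (2 * l) by rewrite ler_pM2l// mulr_gt0.
    apply: (@le_trans _ _ (B^-1 * (B * (l / 2)))).
      rewrite ler_pM2l ?(andP eps01).1// /B.
      by clear -h2' ln2; lra.
    by rewrite mulKf ?gt_eqF ?(lt_trans _ B1)//; clear -L3 C3 ln8 ln2 ln3; lra.
Qed.

End UniformlyPerfectToDelta.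

Theorem theorem1p3 (R : realType) (O : set (R * R)) :
  domain O ->
  ((forall alpha : R, 1 < alpha < 2 -> condU (h1 alpha) (bdry O) ->
      exists alpha' : R, 1 < alpha' /\ condDelta (h1 alpha') O) /\
   (forall alpha' : R, 1 < alpha' -> condDelta (h1 alpha') O ->
      exists alpha : R, 1 < alpha /\ condU (h1 alpha) (bdry O))) /\
  ((exists beta : R, 0 < beta /\ condU (h2 beta) (bdry O)) <->
   (exists beta' : R, 0 < beta' /\ condDelta (h2 beta') O)).
Proof.
move=> dO; split; first split.
- by move=> alpha a12; exact: condU_h1_condDelta.
- by move=> alpha' a1; exact: condDelta_h1_condU.
- split=> [[beta [b0 U]]|[beta' [b0 D]]].
  + exact: condU_h2_condDelta U.
  + exact: condDelta_h2_condU D.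
Qed.
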